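(* For an F-RAN with $M$ edge nodes, each with fractional cache size $\mu\in[0,1]$, $K$ users, a library of $N\ge K$ files and fronthaul capacity $C_F=r\log(P)$ bits per symbol, $r>0$, the minimum NDT for pipelined fronthaul-edge transmission is lower bounded as $$\delta^*_{\mathsf P}(\mu,r)\ \ge\ \max\left\{\max_{\ell\in\{0,1,\dots,\min\{M,K\}\}}\frac{K-(M-\ell)(K-\ell)\mu}{\ell+(M-\ell)r}\,,\ 1\right\}.$$
   Context: F-RAN model with pipelined fronthaul-edge transmission. $M$ edge nodes (ENs) serve $K$ users from a library of $N$ files $F_1,\dots,F_N$, independent and uniform on $\{1,\dots,2^L\}$. The channel $\mathbf H=(h_{km})\in\mathbb C^{K\times M}$ has entries drawn i.i.d. from a continuous distribution, is constant during a transmission interval and known to all nodes. The demand vector $\mathbf D=(d_1,\dots,d_K)\in\{1,\dots,N\}^K$ is known to the cloud and ENs. With power $P$ and fronthaul rate $r$, put $C_F=r\log P$. A policy for file size $L$ with latency $T$ (symbols) consists of: (a) caching functions $S_{m,n}=\pi^m_{c,n}(F_n)$ with entropy $H(S_{m,n})\le\mu L$ (not depending on $\mathbf D,\mathbf H$), with $S_m=(S_{m,1},\dots,S_{m,N})$; (b) fronthaul messages $U_m[1],\dots,U_m[T]$, functions of $(F_1,\dots,F_N,S_m,\mathbf D,\mathbf H)$, sent to EN $m$ over a link of capacity $C_F$ bits per symbol; (c) edge signals $X_m[t]=\pi^m_{\mathsf P,e}(S_m,U_m[1],\dots,U_m[t-1],\mathbf D,\mathbf H)\in\mathbb C$, $t\in\{1,\dots,T\}$,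 with average power at most $P$; (d) decoders $\widehat F_{d_k}=\pi_d^k(Y_k[1],\dots,Y_k[T],d_k,\mathbf H)$, where $Y_k[t]=\sum_{m=1}^M h_{km}X_m[t]+n_k[t]$ with noise i.i.d. $\mathcal{CN}(0,1)$ over time and users. The error probability is $P_e=\max_{\mathbf D}\max_k\mathbb P(\widehat F_{d_k}\ne F_{d_k})$. A sequence of policies indexed by $L$ is feasible if, for almost all $\mathbf H$, $P_e\to0$ as $L\to\infty$. For feasible sequences of policies the achievable NDT is $\delta_{\mathsf P}(\mu,r)=\lim_{P\to\infty}\limsup_{L\to\infty}\frac{T}{L/\log P}$, and the minimum NDT $\delta^*_{\mathsf P}(\mu,r)$ is the infimum of all achievable $\delta_{\mathsf P}(\mu,r)$. *)

(* Defs.v *)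
From HB Require Import structures.
From mathcomp Require Import all_boot all_order all_algebra.
From mathcomp Require Import all_classical all_reals all_analysis.
From mathcomp Require Import complex.

Set Implicit Arguments.
Unset Strict Implicit.
Unset Printing Implicit Defensive.

Import Order.TTheory GRing.Theory Num.Theory.
Import numFieldNormedType.Exports.

Local Open Scope classical_set_scope.
Local Open Scope ring_scope.
Local Open Scope complex_scope.

(* Borel sigma-algebra of the complex plane, transported from R * R. *)
HB.instance Definition _ (R : realType) := isPointed.Build R[i] 0.

Definition reim {R : realType} (z : R[i]) : measurableTypeR R * measurableTypeR R :=
  (complex.Re z, complex.Im z).

Definition complex_display : measure_display.
Proof. exact: default_measure_display. Qed.

Section complex_measurable.
Variable R : realType.

Let cmeas : set (set R[i]) := g_sigma_algebra_preimage (@reim R).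

Let cmeas0 : cmeas set0.
Proof. exact: (@measurable0 _ (g_sigma_algebra_preimageType (@reim R))). Qed.

Let cmeasC A : cmeas A -> cmeas (~` A).
Proof. exact: (@measurableC _ (g_sigma_algebra_preimageType (@reim R))). Qed.

Let cmeas_bigcup (F : (set R[i])^nat) :
  (forall i, cmeas (F i)) -> cmeas (\bigcup_i F i).
Proof.
exact: (@bigcupT_measurable _ (g_sigma_algebra_preimageType (@reim R))).
Qed.

HB.instance Definition _ :=
  isMeasurable.Build complex_display R[i] cmeas0 cmeasC cmeas_bigcup.

End complex_measurable.

Definition of_reim {R : realType} (p : measurableTypeR R * measurableTypeR R) :
    R[i] :=
  (p.1 : R) +i* (p.2 : R).

Lemma measurable_of_reim (R : realType) :
  measurable_fun [set: measurableTypeR R * measurableTypeR R] (@of_reim R).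
Proof.
move=> _ _ [B mB <-]; rewrite !setTI.
rewrite (_ : _ @^-1` _ = B)//; apply/seteqP.
by split=> -[].
Qed.

HB.instance Definition _ (R : realType) :=
  isMeasurableFun.Build _ _ _ _ (@of_reim R) (@measurable_of_reim R).

(* CN(0,1): independent real and imaginary parts of variance 1/2
   (normal_prob takes the standard deviation). *)
Definition cnormal01 (R : realType) : probability R[i] R :=
  let g : probability (measurableTypeR R) R :=
    normal_prob (0 : R) (Num.sqrt 2^-1) in
  distribution (g \x g)%E (@of_reim R).

Definition tcons {T : Type} {n : nat} (p : T * n.-tuple T) : n.+1.-tuple T :=
  [tuple of p.1 :: p.2].

Lemma measurable_tcons d (T : measurableType d) n :
  measurable_fun [set: T * n.-tuple T] (@tcons T n).
Proof. exact: measurable_cons. Qed.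

HB.instance Definition _ d (T : measurableType d) n :=
  isMeasurableFun.Build _ _ _ _ (@tcons T n) (@measurable_tcons d T n).

(* Product measure on T^n: the law of n i.i.d. samples of P. *)
Fixpoint iid_law (R : realType) d (T : measurableType d) (P : probability T R)
    (n : nat) : probability (n.-tuple T) R :=
  match n with
  | 0 => dirac [tuple]
  | m.+1 => distribution (P \x iid_law P m)%E (@tcons T m)
  end.

Definition log2 {R : realType} (x : R) : R := ln x / ln 2.

(* Entropy, in bits, of X(w) for w uniformly distributed on W. *)
Definition entropy {R : realType} {W : finType} {A : eqType} (X : W -> A) : R :=
  let p a : R := #|[pred w | X w == a]|%:R / #|W|%:R in
  - \sum_(a <- undup (codom X)) p a * log2 (p a).

Definition normsq {R : realType} (z : R[i]) : R :=
  complex.Re z ^+ 2 + complex.Im z ^+ 2.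

Notation file L := 'I_(2 ^ L).
Notation library N L := {ffun 'I_N -> file L}.
Notation demands K N := {ffun 'I_K -> 'I_N}.
(* h_{km} is tnth (tnth h k) m *)
Notation channel R K M := (K.-tuple (M.-tuple R[i])).

(* The alphabets of cached contents and of fronthaul symbols are arbitrary;
   one common alphabet for all of them is no loss (take disjoint unions).
   Time is 0-based.  p_edge gets only the fronthaul symbols strictly preceding
   the current time, see [edge_signal].  p_decode k gets d_k, not the whole
   demand vector. *)
Record policy (R : realType) (M K N L : nat) := Policy {
  latency : nat;
  cache_alphabet : eqType;
  fronthaul_alphabet : eqType;
  p_cache : 'I_M -> 'I_N -> file L -> cache_alphabet;
  p_fronthaul : 'I_M -> library N L -> {ffun 'I_N -> cache_alphabet} ->
    demands K N -> channel R K M -> latency.-tuple fronthaul_alphabet;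
  p_edge : 'I_M -> 'I_latency -> {ffun 'I_N -> cache_alphabet} ->
    seq fronthaul_alphabet -> demands K N -> channel R K M -> R[i];
  p_decode : 'I_K -> latency.-tuple R[i] -> 'I_N -> channel R K M -> file L
}.

Arguments p_cache {R M K N L} p.
Arguments p_fronthaul {R M K N L} p.
Arguments p_edge {R M K N L} p.
Arguments p_decode {R M K N L} p.

Section policy_model.
Context {R : realType} {M K N L : nat} (pol : policy R M K N L).
Implicit Types (F : library N L) (D : demands K N) (h : channel R K M).

Definition cache_content (m : 'I_M) F : {ffun 'I_N -> cache_alphabet pol} :=
  [ffun n => p_cache pol m n (F n)].

Definition fronthaul_message (m : 'I_M) D h F :
    (latency pol).-tuple (fronthaul_alphabet pol) :=
  p_fronthaul pol m F (cache_content m F) D h.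

Definition edge_signal (m : 'I_M) (t : 'I_(latency pol)) D h F : R[i] :=
  p_edge pol m t (cache_content m F) (take t (fronthaul_message m D h F)) D h.

Definition received (k : 'I_K) D h F (z : K.-tuple ((latency pol).-tuple R[i])) :
    (latency pol).-tuple R[i] :=
  [tuple \sum_(m < M) tnth (tnth h k) m * edge_signal m t D h F
         + tnth (tnth z k) t | t < latency pol].

(* Probability of a decoding error at user k for demand D over channel h: the
   files are uniform and independent of the i.i.d. noise, hence the average
   over all contents of the library. *)
Definition user_error_prob (h : channel R K M) D (k : 'I_K) : \bar R :=
  ((#|{: library N L}|%:R^-1)%:E * \sum_(F : library N L)
    iid_law (iid_law (cnormal01 R) (latency pol)) K
      [set z | p_decode pol k (received k D h F z) (D k) h != F (D k)])%E.

Definition error_prob (h : channel R K M) : \bar R :=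
  \big[maxe/0%E]_(D : demands K N) \big[maxe/0%E]_(k < K) user_error_prob h D k.

Definition cache_constraint (mu : R) : Prop :=
  forall (m : 'I_M) (n : 'I_N), entropy (p_cache pol m n) <= mu * L%:R.

(* For every realized demand and channel, a link carrying C bits per symbol has
   delivered at most t * C bits after t symbols. *)
Definition fronthaul_constraint (C : R) : Prop :=
  forall (m : 'I_M) D h (t : nat), (t <= latency pol)%N ->
    entropy (fun F => take t (fronthaul_message m D h F)) <= t%:R * C.

(* Average over the transmission interval and over the files; multiplied out by
   the latency. *)
Definition power_constraint (P : R) : Prop :=
  forall (m : 'I_M) D h,
    (#|{: library N L}|%:R^-1) * (\sum_(F : library N L)
      \sum_(t < latency pol) normsq (edge_signal m t D h F))
    <= (latency pol)%:R * P.

Definition measurable_decoders : Prop :=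
  forall (k : 'I_K) (d : 'I_N) (h : channel R K M) (a : file L),
    measurable [set y | p_decode pol k y d h = a].

Definition admissible (mu r P : R) : Prop :=
  [/\ cache_constraint mu, fronthaul_constraint (r * log2 P),
      power_constraint P & measurable_decoders].

End policy_model.

(* nu is the common law of the i.i.d. channel coefficients. *)
Definition channel_law (R : realType) (K M : nat) (nu : probability R[i] R) :
    probability (channel R K M) R :=
  iid_law (iid_law nu M) K.

Definition feasible (R : realType) (M K N : nat) (nu : probability R[i] R)
    (pol : forall L, policy R M K N L) : Prop :=
  {ae channel_law K M nu, forall h,
     (fun L => error_prob (pol L) h) @ \oo --> 0%E}.

(* File sizes are in bits, hence the base-2 logarithm. *)
Definition normalized_latency (R : realType) (M K N : nat) (P : R)
    (pol : forall L, policy R M K N L) : \bar R :=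
  limn_esup (fun L => ((latency (pol L))%:R / (L%:R / log2 P))%:E).

(* pol P L is the policy used at power P for file size L. *)
Definition achievable_ndt (R : realType) (M K N : nat) (nu : probability R[i] R)
    (mu r : R) (delta : \bar R) : Prop :=
  exists pol : R -> forall L, policy R M K N L,
    (\forall P \near +oo,
       (forall L, admissible (pol P L) mu r P) /\ feasible nu (pol P)) /\
    (fun P => normalized_latency P (pol P)) @ +oo --> delta.

Definition min_ndt (R : realType) (M K N : nat) (nu : probability R[i] R)
    (mu r : R) : \bar R :=
  ereal_inf [set delta | achievable_ndt M K N nu mu r delta].

(* Main.v *)
(** Fix a channel whose square minors are invertible and consider pairwise
    distinct demands.  A decoder that sees the outputs of [l] users together with
    the cache contents and fronthaul messages of [M - l] edge nodes can predict the
    signals of the remaining users up to a bounded linear function of the noise.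
    Instead of manipulating mutual informations, compare the true law of the outputs
    with a reference law: the first [l] outputs are i.i.d. Gaussian of variance [P],
    the side information is guessed from the product of its marginals, and the other
    outputs are centred at the values predicted from both.  Under the reference law
    the guess is right and the decoders succeed with probability at most
    [2 ^ -(L K)] on average over the library, while the expected log-likelihood
    ratio is at most [l T ln P + O(T)] plus the entropies of the guessed variables;
    hence
    [K L <= T (l + (M - l) r) log P + (M - l) (K - l) mu L + O(T) + o(L)].
    The bound [1] is the case of one user and no side information. *)

Require Import Defs.
From HB Require Import structures.
From mathcomp Require Import all_boot all_order all_algebra.
From mathcomp Require Import all_classical all_reals all_analysis.
From mathcomp Require Import measurable_realfun complex.
From mathcomp Require Import perm ring lra.

Set Implicit Arguments.
Unset Strict Implicit.
Unset Printing Implicit Defensive.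

Import Order.TTheory GRing.Theory Num.Theory.
Import numFieldNormedType.Exports.

Local Open Scope classical_set_scope.
Local Open Scope ring_scope.

(** * Gaussian changes of measure *)

(** The outputs are continuous and the cache and fronthaul alphabets are arbitrary, so a chain of
    mutual informations would mix discrete and differential entropies. Here every likelihood ratio
    is a weight on the noise, and the discrete side becomes a count of libraries. Variance [P] is
    the scale of the head signals: under the power constraint their energy divided by [P] stays
    bounded per symbol, so a head symbol costs [ln P] up to a constant. A tail symbol costs only a
    constant, because the error of its prediction contains no signal. The factor [K - l] next to
    [mu] arises because caches are guessed only on the files wanted by the tail users: the head
    files are decoded from the head outputs, and files outside the demand are held fixed in the
    count. The constant in [O(T)] depends on the channel, so the power must be chosen after the
    channel. Almost sure feasibility is therefore needed for arbitrarily large powers at once, which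
    a countable sequence of powers provides. *)

Lemma lebesgue_measure_affine (R : realType) (c s : R) (A : set R) :
  0 < s -> measurable A ->
  lebesgue_measure A =
  (s%:E * lebesgue_measure ((fun u : R => c + s * u)%R @^-1` A))%E.
Proof.
move=> s0 mA.
pose phi : measurableTypeR R -> measurableTypeR R := fun u => c + s * u.
have mphi : measurable_fun setT phi.
  by apply: measurable_funD => //; exact: measurable_funM.
pose phi' : {mfun _ >-> _} := HB.pack phi (isMeasurableFun.Build _ _ _ _ _ mphi).
pose s' : {nonneg R} := NngNum (ltW s0).
(* By uniqueness, it suffices that the rescaled image measure has the right value on half-open
   intervals. *)
apply: (@lebesgue_measure_unique _
  (mscale s' (pushforward (@lebesgue_measure R) phi'))) => //= _ [[x y] _ <-].
rewrite /mscale /pushforward/=.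
rewrite [X in (_ * lebesgue_measure X)%E](_ : _ = [set` `](x - c) / s, (y - c) / s]]); last first.
  apply/seteqP; split => u /=; rewrite !in_itv/= /phi.
    by move=> /andP[h1 h2]; rewrite ltr_pdivrMr// ler_pdivlMr// ltrBlDl lerBrDl mulrC h1 h2.
  by rewrite ltr_pdivrMr// ler_pdivlMr// ltrBlDl lerBrDl mulrC.
rewrite !lebesgue_measure_itv/= !lte_fin ltr_pM2r ?invr_gt0// ltrD2r.
case: ifPn => // _; last by rewrite mule0.
by rewrite -!EFinD -EFinM -mulrBl mulrC divfK ?gt_eqF//; congr EFin; lra.
Qed.

Lemma ge0_integral_affine (R : realType) (c s : R) (f : measurableTypeR R -> \bar R) :
  0 < s -> measurable_fun [set: measurableTypeR R] f -> (forall x, 0 <= f x)%E ->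
  (\int[lebesgue_measure]_x f x =
   s%:E * \int[lebesgue_measure]_x f (c + s * x)%R)%E.
Proof.
move=> s0 mf f0.
pose phi : measurableTypeR R -> measurableTypeR R := fun u => c + s * u.
have mphi : measurable_fun setT phi.
  by apply: measurable_funD => //; exact: measurable_funM.
pose phi' : {mfun _ >-> _} := HB.pack phi (isMeasurableFun.Build _ _ _ _ _ mphi).
pose s' : {nonneg R} := NngNum (ltW s0).
rewrite (@eq_measure_integral _ _ _ _ (mscale s' (pushforward (@lebesgue_measure R) phi'))).
  by rewrite ge0_integral_mscale//= ge0_integral_pushforward.
by move=> A mA _; exact: lebesgue_measure_affine.
Qed.

(** The abstract Radon-Nikodym derivative equals [normal_pdf] almost everywhere, since both
    integrate to [normal_prob] over every measurable set. *)
Lemma ge0_integral_normal_prob (R : realType) (m s : R) (f : measurableTypeR R -> \bar R) :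
  measurable_fun [set: measurableTypeR R] f -> (forall x, 0 <= f x)%E ->
  (\int[normal_prob m s]_x f x =
   \int[lebesgue_measure]_x (f x * (normal_pdf m s x)%:E))%E.
Proof.
move=> mf f0.
rewrite -(Radon_Nikodym_SigmaFinite.change_of_variables (normal_prob_dominates m s))//.
have mrn := Radon_Nikodym_SigmaFinite.f_integrable (normal_prob_dominates m s).
apply: ae_eq_integral => //.
- by apply: emeasurable_funM => //; exact: (measurable_int _ mrn).
- apply: emeasurable_funM => //; apply/measurable_EFinP; exact: measurable_normal_pdf.
- apply: ae_eqe_mul2l => /=; apply: integral_ae_eq => //.
    by apply/measurable_EFinP; exact: measurable_normal_pdf.
  move=> E _ mE; rewrite -Radon_Nikodym_SigmaFinite.f_integral//.
  exact: normal_prob_dominates.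
Qed.

(** Weak form of: the law of [beta] has a density with respect to the law of [alpha]. The density is
    read at the noise sample [x] instead of at the output [alpha x], so that no dominating measure
    on tuples of complex numbers is involved. *)
Definition law_change d (X : measurableType d) (R : realType)
    (P : probability X R) (alpha beta : X -> X) (w : X -> R) : Prop :=
  [/\ measurable_fun [set: X] alpha, measurable_fun [set: X] beta,
      measurable_fun [set: X] w, (forall x, 0 <= w x) &
      forall f : X -> \bar R, measurable_fun [set: X] f ->
        (forall x, 0 <= f x)%E ->
        (\int[P]_x (f (alpha x) * (w x)%:E) = \int[P]_x f (beta x))%E].

(* Ratio of the densities of [b + s X] and [a + X] at [a + x], for [X] of variance
   1/2, i.e. of density proportional to [expR (- x ^+ 2)]. *)
Definition gauss_ratio (R : realType) (s a b x : R) : R :=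
  s^-1 * expR (x ^+ 2 - (a + x - b) ^+ 2 / s ^+ 2).

Lemma law_change_normal (R : realType) (s a b : R) : 0 < s ->
  law_change (normal_prob 0 (Num.sqrt 2^-1) : probability (measurableTypeR R) R)
    (fun x => a + x) (fun x => b + s * x) (gauss_ratio s a b).
Proof.
move=> s0.
have mw : measurable_fun [set: measurableTypeR R] (gauss_ratio s a b).
  apply: measurable_funM => //; apply: measurableT_comp => //.
  apply: measurable_funB; first exact: measurable_funX.
  apply: measurable_funM => //; apply: measurable_funX.
  by apply: measurable_funB => //; exact: measurable_funD.
have ma : measurable_fun [set: measurableTypeR R]
  (fun x : measurableTypeR R => a + x : measurableTypeR R) by exact: measurable_funD.
have mb : measurable_fun [set: measurableTypeR R]
    (fun x : measurableTypeR R => b + s * x : measurableTypeR R).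
  by apply: measurable_funD => //; exact: measurable_funM.
have w0 x : 0 <= gauss_ratio s a b x.
  by rewrite mulr_ge0 ?expR_ge0// invr_ge0 ltW.
split => // f mf f0.
have mpdf : measurable_fun [set: measurableTypeR R]
    (EFin \o normal_pdf 0 (Num.sqrt 2^-1) : measurableTypeR R -> \bar R).
  by apply/measurable_EFinP; exact: measurable_normal_pdf.
have mfa : measurable_fun [set: measurableTypeR R]
    (fun x : measurableTypeR R => f (a + x)) by exact: measurableT_comp mf ma.
have mfb : measurable_fun [set: measurableTypeR R]
    (fun x : measurableTypeR R => f (b + s * x)) by exact: measurableT_comp mf mb.
have mfw : measurable_fun [set: measurableTypeR R]
    (fun x : measurableTypeR R => f (a + x)%R * (gauss_ratio s a b x)%:E)%E.
  by apply: emeasurable_funM => //; exact/measurable_EFinP.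
rewrite ge0_integral_normal_prob//; last first.
  by move=> x; rewrite mule_ge0 ?lee_fin.
rewrite ge0_integral_normal_prob//.
(* Replacing [x] by [b - a + s * x] turns [a + x] into [b + s * x]; the Jacobian [s] and the weight
   then restore the Gaussian density at the old [x]. *)
rewrite (ge0_integral_affine (b - a) s0); last 2 first.
- exact: emeasurable_funM.
- by move=> x; rewrite !mule_ge0 ?lee_fin ?normal_pdf_ge0.
have mc : measurable_fun [set: measurableTypeR R]
    (fun x : measurableTypeR R => b - a + s * x : measurableTypeR R).
  by apply: measurable_funD => //; exact: measurable_funM.
rewrite -ge0_integralZl//; last 3 first.
- apply: (measurableT_comp _ mc (f := fun x : measurableTypeR R =>
    f (a + x)%R * (gauss_ratio s a b x)%:E *
    (normal_pdf 0 (Num.sqrt 2^-1) x)%:E)%E).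
  exact: emeasurable_funM.
- by move=> x _; rewrite !mule_ge0 ?lee_fin ?normal_pdf_ge0.
- by rewrite lee_fin ltW.
apply: eq_integral => x _.
have -> : a + (b - a + s * x) = b + s * x by lra.
rewrite [LHS]muleC -!muleA; congr (_ * _)%E; rewrite -!EFinM; congr EFin.
have v0 : Num.sqrt (2^-1 : R) != 0 by rewrite gt_eqF// sqrtr_gt0.
rewrite !(normal_pdfE _ v0) /normal_fun sqr_sqrtr// /gauss_ratio.
rewrite !subr0 -(mulr_natr 2^-1) mulVf// !divr1.
have -> : (a + (b - a + s * x) - b) ^+ 2 / s ^+ 2 = x ^+ 2.
  rewrite (_ : a + _ - b = s * x); last by lra.
  by rewrite exprMn mulrAC divff ?mul1r// sqrf_eq0 gt_eqF.
have -> : expR (- x ^+ 2) = expR ((b - a + s * x) ^+ 2 - x ^+ 2) *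
    expR (- (b - a + s * x) ^+ 2).
  by rewrite -expRD; congr expR; ring.
by field; rewrite gt_eqF.
Qed.

Section law_change_prod.
Context d1 d2 (X1 : measurableType d1) (X2 : measurableType d2) (R : realType).
Variables (P1 : probability X1 R) (P2 : probability X2 R).

(** Tonelli, one factor at a time: with the first coordinate fixed the second law is changed, and
    the resulting partial integral [g] is a legitimate test function for the first. *)
Lemma law_change_prod a1 b1 w1 a2 b2 w2 :
  law_change P1 a1 b1 w1 -> law_change P2 a2 b2 w2 ->
  law_change (P1 \x P2)%E (fun z => (a1 z.1, a2 z.2)) (fun z => (b1 z.1, b2 z.2))
    (fun z => w1 z.1 * w2 z.2).
Proof.
move=> [ma1 mb1 mw1 w10 E1] [ma2 mb2 mw2 w20 E2].
have ma : measurable_fun [set: X1 * X2] (fun z => (a1 z.1, a2 z.2)).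
  apply/measurable_fun_pairP; split.
    exact: (measurableT_comp ma1 measurable_fst).
  exact: (measurableT_comp ma2 measurable_snd).
have mb : measurable_fun [set: X1 * X2] (fun z => (b1 z.1, b2 z.2)).
  apply/measurable_fun_pairP; split.
    exact: (measurableT_comp mb1 measurable_fst).
  exact: (measurableT_comp mb2 measurable_snd).
have mw : measurable_fun [set: X1 * X2] (fun z => w1 z.1 * w2 z.2).
  apply: measurable_funM.
    exact: (measurableT_comp mw1 measurable_fst).
  exact: (measurableT_comp mw2 measurable_snd).
split => //; first by move=> z; rewrite mulr_ge0.
move=> f mf f0.
rewrite fubini_tonelli1; last 2 first.
- apply: emeasurable_funM; first exact: (measurableT_comp mf ma).
  exact/measurable_EFinP.
- by move=> z; rewrite mule_ge0// lee_fin mulr_ge0.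
rewrite fubini_tonelli1//; last exact: (measurableT_comp mf mb).
rewrite /fubini_F/=.
pose g x := (\int[P2]_y f (x, b2 y))%E.
have mfb2 : measurable_fun [set: X1 * X2] (fun z => f (z.1, b2 z.2)).
  apply: (measurableT_comp mf); apply/measurable_fun_pairP; split.
    exact: measurable_fst.
  exact: (measurableT_comp mb2 measurable_snd).
have mg : measurable_fun setT g.
  by apply: (@measurable_fun_fubini_tonelli_F _ _ _ _ _ P2 (fun z => f (z.1, b2 z.2))) => //.
have g0 x : (0 <= g x)%E by apply: integral_ge0.
rewrite -[RHS]/(\int[P1]_x (g (b1 x)))%E -E1//.
apply: eq_integral => x _.
transitivity (\int[P2]_y ((f (a1 x, a2 y) * (w2 y)%:E) * (w1 x)%:E))%E.
  by apply: eq_integral => y _; rewrite EFinM -muleA (muleC (w1 x)%:E).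
have mfx : measurable_fun setT (fun y => f (a1 x, y)).
  apply: (measurableT_comp mf); exact: pair1_measurable.
rewrite ge0_integralZr//.
- by rewrite (E2 (fun y => f (a1 x, y))).
- apply: emeasurable_funM; last exact/measurable_EFinP.
  exact: (measurableT_comp mfx).
- by move=> y _; rewrite mule_ge0 ?lee_fin.
- by rewrite lee_fin.
Qed.

End law_change_prod.

(** Serves twice: to pass from pairs of reals to complex numbers, and from a head paired with a tail
    to a longer tuple. *)
Lemma law_change_distribution d d' (X : measurableType d) (Y : measurableType d')
    (R : realType) (P : probability X R) (phi : {RV P >-> Y}) a b w
    (a' b' : Y -> Y) (w' : Y -> R) :
  law_change P a b w ->
  measurable_fun setT a' -> measurable_fun setT b' -> measurable_fun setT w' ->
  (forall y, 0 <= w' y) ->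
  (forall x, a' (phi x) = phi (a x)) -> (forall x, b' (phi x) = phi (b x)) ->
  (forall x, w' (phi x) = w x) ->
  law_change (distribution P phi) a' b' w'.
Proof.
move=> [ma mb mw w0 E] ma' mb' mw' w0' Ea Eb Ew; split => // f mf f0.
rewrite ge0_integral_distribution//; last 2 first.
- apply: emeasurable_funM; last exact/measurable_EFinP.
  exact: (measurableT_comp mf).
- by move=> y; rewrite mule_ge0 ?lee_fin.
rewrite ge0_integral_distribution//; last exact: (measurableT_comp mf).
transitivity (\int[P]_x (f (phi (a x)) * (w x)%:E))%E.
  by apply: eq_integral => x _ /=; rewrite Ea Ew.
have mfp : measurable_fun setT (f \o phi) by exact: (measurableT_comp mf).
rewrite (E (f \o phi))//; last by move=> x; exact: f0.
by apply: eq_integral => x _ /=; rewrite Eb.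
Qed.

Lemma law_change_iid d (X : measurableType d) (R : realType)
    (P : probability X R) n (a b : 'I_n -> X -> X) (w : 'I_n -> X -> R) :
  (forall i, law_change P (a i) (b i) (w i)) ->
  law_change (iid_law P n)
    (fun z => [tuple a i (tnth z i) | i < n])
    (fun z => [tuple b i (tnth z i) | i < n])
    (fun z => \prod_(i < n) w i (tnth z i)).
Proof.
have mtup m (c : 'I_m -> X -> X) : (forall i, measurable_fun setT (c i)) ->
    measurable_fun [set: m.-tuple X] (fun z => [tuple c i (tnth z i) | i < m]).
  move=> mc; apply/measurable_fun_tnthP => i.
  rewrite (_ : _ \o _ = fun z => c i (tnth z i)); last first.
    by apply/funext => z /=; rewrite tnth_mktuple.
  apply: (measurableT_comp (mc i)); exact: measurable_tnth.
have mprod m (v : 'I_m -> X -> R) : (forall i, measurable_fun setT (v i)) ->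
    measurable_fun [set: m.-tuple X] (fun z => \prod_(i < m) v i (tnth z i)).
  move=> mv; apply: measurable_prod => i _.
  apply: (measurableT_comp (mv i)); exact: measurable_tnth.
elim: n a b w => [|n IH] a b w H.
  split.
  - by apply: mtup => -[].
  - by apply: mtup => -[].
  - by apply: mprod => -[].
  - by move=> z; rewrite big_ord0.
  move=> f mf f0; apply: eq_integral => z _.
  by rewrite big_ord0 mule1; congr f; apply/eq_from_tnth => -[].
have Hma i : measurable_fun setT (a i) by case: (H i).
have Hmb i : measurable_fun setT (b i) by case: (H i).
have Hmw i : measurable_fun setT (w i) by case: (H i).
have Hw0 i x : 0 <= w i x by case: (H i).
have tupE (c : 'I_n.+1 -> X -> X) (x : X * n.-tuple X) :
    [tuple c i (tnth (tcons x) i) | i < n.+1] =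
    tcons (c ord0 x.1, [tuple c (lift ord0 i) (tnth x.2 i) | i < n]).
  apply/eq_from_tnth => i; rewrite tnth_mktuple /tcons.
  case: (unliftP ord0 i) => [j|] ->; last by rewrite !tnth0.
  by rewrite !tnthS tnth_mktuple.
have IHn := IH _ _ _ (fun i => H (lift ord0 i)).
apply: (law_change_distribution (law_change_prod (H ord0) IHn)) => //=.
- exact: mtup.
- exact: mtup.
- exact: mprod.
- by move=> z; apply: prodr_ge0.
- move=> x; rewrite big_ord_recl tnth0; congr (_ * _).
  by apply: eq_bigr => i _; rewrite tnthS.
Qed.

(** * Measurability of complex-valued functions and estimates on squared moduli *)

Section complex_measurability.
Context {R : realType} d (T : measurableType d).
Implicit Types f g : T -> R[i].

Lemma measurable_reim : measurable_fun [set: R[i]] (@reim R).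
Proof. by move=> _ A mA; rewrite setTI; exists A => //; rewrite setTI. Qed.

Lemma measurable_Re :
  measurable_fun [set: R[i]] (fun z => complex.Re z : measurableTypeR R).
Proof. exact: (measurableT_comp measurable_fst measurable_reim). Qed.

Lemma measurable_Im :
  measurable_fun [set: R[i]] (fun z => complex.Im z : measurableTypeR R).
Proof. exact: (measurableT_comp measurable_snd measurable_reim). Qed.

Lemma measurable_complexP f :
  measurable_fun [set: T] f <->
  measurable_fun [set: T] (fun x => complex.Re (f x) : measurableTypeR R) /\
  measurable_fun [set: T] (fun x => complex.Im (f x) : measurableTypeR R).
Proof.
split=> [mf|[mre mim]].
  split; first exact: (measurableT_comp measurable_Re mf).
  exact: (measurableT_comp measurable_Im mf).
rewrite (_ : f = @of_reim R \o (fun x => (complex.Re (f x) : measurableTypeR R,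
    complex.Im (f x) : measurableTypeR R))); last first.
  by apply/funext => x /=; rewrite /of_reim/=; case: (f x).
apply: (measurableT_comp (@measurable_of_reim R)).
by apply/measurable_fun_pairP.
Qed.

Lemma measurable_complexD f g : measurable_fun [set: T] f ->
  measurable_fun [set: T] g -> measurable_fun [set: T] (fun x => f x + g x).
Proof.
move=> /measurable_complexP[f1 f2] /measurable_complexP[g1 g2].
apply/measurable_complexP; split.
  rewrite (_ : (fun _ => _) = fun x => complex.Re (f x) + complex.Re (g x)).
    exact: measurable_funD.
  by apply/funext => x; case: (f x) (g x) => [? ?] [? ?].
rewrite (_ : (fun _ => _) = fun x => complex.Im (f x) + complex.Im (g x)).
  exact: measurable_funD.
by apply/funext => x; case: (f x) (g x) => [? ?] [? ?].
Qed.

Lemma measurable_complexM f g : measurable_fun [set: T] f ->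
  measurable_fun [set: T] g -> measurable_fun [set: T] (fun x => f x * g x).
Proof.
move=> /measurable_complexP[f1 f2] /measurable_complexP[g1 g2].
apply/measurable_complexP; split.
  rewrite (_ : (fun _ => _) = fun x => complex.Re (f x) * complex.Re (g x) -
      complex.Im (f x) * complex.Im (g x)).
    by apply: measurable_funB; exact: measurable_funM.
  by apply/funext => x; case: (f x) (g x) => [? ?] [? ?].
rewrite (_ : (fun _ => _) = fun x => complex.Re (f x) * complex.Im (g x) +
    complex.Im (f x) * complex.Re (g x)).
  by apply: measurable_funD; exact: measurable_funM.
by apply/funext => x; case: (f x) (g x) => [? ?] [? ?].
Qed.

Lemma measurable_complex_sum (I : Type) (s : seq I) (F : I -> T -> R[i]) :
  (forall i, measurable_fun [set: T] (F i)) ->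
  measurable_fun [set: T] (fun x => \sum_(i <- s) F i x).
Proof.
move=> mF; elim: s => [|i s IH].
  by rewrite (_ : (fun _ => _) = cst 0)//; apply/funext => x; rewrite big_nil.
rewrite (_ : (fun _ => _) = fun x => F i x + \sum_(j <- s) F j x).
  exact: measurable_complexD.
by apply/funext => x; rewrite big_cons.
Qed.

Lemma measurable_complex_prod (I : Type) (s : seq I) (F : I -> T -> R[i]) :
  (forall i, measurable_fun [set: T] (F i)) ->
  measurable_fun [set: T] (fun x => \prod_(i <- s) F i x).
Proof.
move=> mF; elim: s => [|i s IH].
  by rewrite (_ : (fun _ => _) = cst 1)//; apply/funext => x; rewrite big_nil.
rewrite (_ : (fun _ => _) = fun x => F i x * \prod_(j <- s) F j x).
  exact: measurable_complexM.
by apply/funext => x; rewrite big_cons.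
Qed.

Lemma measurable_normsq f : measurable_fun [set: T] f ->
  measurable_fun [set: T] (fun x => normsq (f x)).
Proof.
move=> /measurable_complexP[f1 f2].
by apply: measurable_funD; exact: measurable_funX.
Qed.

End complex_measurability.

Section normsq_theory.
Variable R : realType.
Implicit Types u v : R[i].

Lemma normsq_ge0 u : 0 <= normsq u.
Proof. by rewrite addr_ge0// sqr_ge0. Qed.

Lemma normsqM u v : normsq (u * v) = normsq u * normsq v.
Proof. by case: u v => [a b] [c e]; rewrite /normsq/=; ring. Qed.

Lemma normsq_sum n (F : 'I_n -> R[i]) :
  normsq (\sum_(i < n) F i) <= n%:R * \sum_(i < n) normsq (F i).
Proof.
elim: n F => [|n IH] F.
  by rewrite !big_ord0 /normsq/= expr0n/= mulr0 addr0.
rewrite !big_ord_recl; set s := \sum_(i < n) _; set S := \sum_(i < n) _.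
have sS : normsq s <= n%:R * S by exact: IH.
have S0 : 0 <= S by apply: sumr_ge0 => i _; exact: normsq_ge0.
have [n0|n0] := eqVneq n 0%N.
  by rewrite /s /S; subst n; rewrite !big_ord0 !addr0; lra.
have n0' : (0 : R) < n%:R by rewrite ltr0n lt0n.
(* AM-GM: 2 u.s <= n |u|^2 + |s|^2 / n *)
have h : normsq (F ord0 + s) <= normsq (F ord0) + normsq s +
    (n%:R * normsq (F ord0) + normsq s / n%:R).
  rewrite -subr_ge0; set N := n%:R.
  have -> : normsq (F ord0) + normsq s + (N * normsq (F ord0) + normsq s / N) -
      normsq (F ord0 + s) =
      ((N * complex.Re (F ord0) - complex.Re s) ^+ 2 +
       (N * complex.Im (F ord0) - complex.Im s) ^+ 2) / N.
    case: (F ord0) s {sS} => [a b] [c e]; rewrite /normsq/=.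
    by field; rewrite gt_eqF.
  by rewrite divr_ge0 ?addr_ge0 ?sqr_ge0// ltW.
apply: (le_trans h); rewrite -(natr1 n).
have : normsq s / n%:R <= S by rewrite ler_pdivrMr// mulrC.
lra.
Qed.

Lemma normsqD u v : normsq (u + v) <= 2 * normsq u + 2 * normsq v.
Proof.
case: u v => [a b] [c e]; rewrite /normsq/=.
by have := sqr_ge0 (a - c); have := sqr_ge0 (b - e); nra.
Qed.

Lemma normsqB u v : normsq (u - v) <= 2 * normsq u + 2 * normsq v.
Proof.
case: u v => [a b] [c e]; rewrite /normsq/=.
by have := sqr_ge0 (a + c); have := sqr_ge0 (b + e); nra.
Qed.

End normsq_theory.

Definition cgauss_ratio (R : realType) (s : R) (a b z : R[i]) : R :=
  (s ^+ 2)^-1 * expR (normsq z - normsq (a + z - b) / s ^+ 2).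

Lemma cgauss_ratio_ge0 (R : realType) (s : R) (a b z : R[i]) :
  0 <= cgauss_ratio s a b z.
Proof. by rewrite mulr_ge0 ?expR_ge0// invr_ge0 sqr_ge0. Qed.

Lemma law_change_cnormal (R : realType) (s : R) (a b : R[i]) : 0 < s ->
  law_change (cnormal01 R) (fun z => a + z) (fun z => b + s%:C%C * z)
    (cgauss_ratio s a b).
Proof.
move=> s0.
have H := law_change_prod (law_change_normal (complex.Re a) (complex.Re b) s0)
  (law_change_normal (complex.Im a) (complex.Im b) s0).
apply: (law_change_distribution H).
- by apply: measurable_complexD.
- by apply: measurable_complexD => //; exact: measurable_complexM.
- apply: measurable_funM => //; apply: measurableT_comp => //.
  apply: measurable_funB; first exact: measurable_normsq.
  apply: measurable_funM => //; apply: measurable_normsq.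
  by apply: measurable_complexD => //; exact: measurable_complexD.
- exact: cgauss_ratio_ge0.
- by move=> [x y]; rewrite /of_reim/=; case: a {H}.
- move=> [x y]; rewrite /of_reim/=; case: b {H} => b1 b2.
  by apply/eqP; rewrite eq_complex/= !mul0r subr0 addr0 !eqxx.
- move=> [x y]; rewrite /of_reim/= /gauss_ratio /cgauss_ratio.
  rewrite mulrACA -expRD -invfM -expr2; congr (_ * expR _).
  by case: a b {H} => [a1 a2] [b1 b2]; rewrite /normsq/=; ring.
Qed.

(* Doubling the variance has density ratio [expR (normsq z / 2) / 2], of integral 1. *)
Lemma integral_normsq_cnormal (R : realType) :
  (\int[cnormal01 R]_z (normsq z)%:E <= 4%:E)%E.
Proof.
have s0 : 0 < Num.sqrt (2 : R) by rewrite sqrtr_gt0.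
have [_ _ mw w0 E] := law_change_cnormal 0 0 s0.
have := E (cst 1%E) (measurable_cst _) (fun=> lee01).
rewrite integral_cst//= probability_setT mule1 => E1.
rewrite -[leRHS]mule1 -E1.
have mw' : measurable_fun [set: R[i]] (fun z => (1 * (cgauss_ratio (Num.sqrt 2) 0 0 z)%:E)%E).
  by apply: emeasurable_funM => //; exact/measurable_EFinP.
rewrite -ge0_integralZl//; last by move=> z _; rewrite mul1e lee_fin.
apply: ge0_le_integral => //.
- by move=> z _; rewrite lee_fin normsq_ge0.
- by apply/measurable_EFinP; exact: measurable_normsq.
- exact: emeasurable_funM.
move=> z _; rewrite mul1e -EFinM lee_fin /cgauss_ratio sqr_sqrtr//.
rewrite add0r subr0; have := expR_ge1Dx (normsq z - normsq z / 2).
have := normsq_ge0 z; lra.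
Qed.

Lemma integral_probability_cst d (X : measurableType d) (R : realType)
    (P : probability X R) (c : \bar R) : (\int[P]_x c = c)%E.
Proof.
rewrite (integral_cst P measurableT) -[RHS]mule1.
by congr (_ * _)%E; exact: probability_setT.
Qed.

(** * Marginals and splittings of i.i.d. laws *)

Section iid_marginals.
Context d (X : measurableType d) (R : realType) (P : probability X R).

Lemma integral_iidS n (f : n.+1.-tuple X -> \bar R) :
  measurable_fun setT f -> (forall z, 0 <= f z)%E ->
  (\int[iid_law P n.+1]_z f z =
   \int[P]_x \int[iid_law P n]_z f (tcons (x, z)))%E.
Proof.
move=> mf f0; rewrite /= ge0_integral_distribution// fubini_tonelli1//.
  exact: (measurableT_comp mf (@measurable_tcons _ X n)).
by move=> z; exact: f0.
Qed.

Lemma integral_iid_tnth n (i : 'I_n) (f : X -> \bar R) :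
  measurable_fun setT f -> (forall x, 0 <= f x)%E ->
  (\int[iid_law P n]_z f (tnth z i) = \int[P]_x f x)%E.
Proof.
move=> mf f0; elim: n i => [[]//|n IH i].
rewrite integral_iidS//; last exact: (measurableT_comp mf (measurable_tnth i)).
case: (unliftP ord0 i) => [j|] ->.
  under eq_integral do under eq_integral do rewrite tnthS.
  under eq_integral do rewrite IH.
  exact: integral_probability_cst.
apply: eq_integral => x _.
transitivity (\int[iid_law P n]_z f x)%E.
  by apply: eq_integral => z _; rewrite tnth0.
exact: integral_probability_cst.
Qed.

Lemma measurable_cat_tuple l m :
  measurable_fun [set: l.-tuple X * m.-tuple X]
    (fun p => [tuple of p.1 ++ p.2] : (l + m).-tuple X).
Proof.
apply/measurable_fun_tnthP => i.
case: (split_ordP i) => j ->.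
  rewrite (_ : _ \o _ = fun p => tnth p.1 j).
    exact: (measurableT_comp (measurable_tnth j) measurable_fst).
  by apply/funext => p /=; rewrite tnth_lshift.
rewrite (_ : _ \o _ = fun p => tnth p.2 j).
  exact: (measurableT_comp (measurable_tnth j) measurable_snd).
by apply/funext => p /=; rewrite tnth_rshift.
Qed.

Lemma integral_iid_cat l m (f : (l + m).-tuple X -> \bar R) :
  measurable_fun setT f -> (forall z, 0 <= f z)%E ->
  (\int[iid_law P (l + m)]_z f z =
   \int[iid_law P l]_u \int[iid_law P m]_v f [tuple of u ++ v])%E.
Proof.
elim: l f => [|l IH] f mf f0.
  rewrite [RHS]integral_dirac//; last first.
    rewrite (_ : (fun _ => _) = cst (\int[iid_law P m]_v f v))%E//.
    apply/funext => u; apply: eq_integral => v _; congr f; apply/val_inj => /=.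
    by rewrite (tuple0 u).
  rewrite diracT mul1e; apply: eq_integral => v _; congr f; exact/val_inj.
have mF : measurable_fun [set: l.+1.-tuple X]
    (fun u => \int[iid_law P m]_v f [tuple of u ++ v])%E.
  pose h (p : l.+1.-tuple X * m.-tuple X) := f [tuple of p.1 ++ p.2].
  have mh : measurable_fun setT h.
    exact: (measurableT_comp mf (@measurable_cat_tuple l.+1 m)).
  exact: (@measurable_fun_fubini_tonelli_F _ _ _ _ _ (iid_law P m) h mh (fun p => f0 _)).
rewrite integral_iidS//; last by move=> u; exact: integral_ge0.
rewrite [LHS](@integral_iidS (l + m))//.
apply: eq_integral => x _; rewrite IH//; last first.
  apply: (measurableT_comp mf); apply: (measurableT_comp (@measurable_tcons _ X (l + m))).
  exact: pair1_measurable.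
apply: eq_integral => u _; apply: eq_integral => v _; congr f; exact/val_inj.
Qed.

End iid_marginals.

(** * Tilting the law of the received signals *)

Section row_changes.
Variable R : realType.
Implicit Types s : R.

Lemma law_change_row n s (a b : 'I_n -> R[i]) : 0 < s ->
  law_change (iid_law (cnormal01 R) n)
    (fun z => [tuple a t + tnth z t | t < n])
    (fun z => [tuple b t + s%:C%C * tnth z t | t < n])
    (fun z => \prod_(t < n) cgauss_ratio s (a t) (b t) (tnth z t)).
Proof.
by move=> s0; exact: (law_change_iid (fun t => law_change_cnormal (a t) (b t) s0)).
Qed.

Lemma law_change_block k n s (a b : 'I_k -> 'I_n -> R[i]) : 0 < s ->
  law_change (iid_law (iid_law (cnormal01 R) n) k)
    (fun z => [tuple [tuple a i t + tnth (tnth z i) t | t < n] | i < k])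
    (fun z => [tuple [tuple b i t + s%:C%C * tnth (tnth z i) t | t < n] | i < k])
    (fun z => \prod_(i < k) \prod_(t < n)
       cgauss_ratio s (a i t) (b i t) (tnth (tnth z i) t)).
Proof.
by move=> s0; exact: (law_change_iid (fun i => law_change_row (a i) (b i) s0)).
Qed.

End row_changes.

Section tilting.
Variables (R : realType) (l m n : nat) (s : R).
Variables (a : 'I_(l + m) -> 'I_n -> R[i]) (kap : 'I_m -> 'I_n -> R[i]).
Variable G : 'I_m -> 'I_l -> R[i].
Hypothesis s1 : 1 <= s.
Hypothesis aE : forall k t, a (rshift l k) t = kap k t + \sum_j G k j * a (lshift m j) t.

Let noise k := iid_law (iid_law (cnormal01 R) n) k.

Definition noisy_output (z : (l + m).-tuple (n.-tuple R[i])) :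
    (l + m).-tuple (n.-tuple R[i]) :=
  [tuple [tuple a k t + tnth (tnth z k) t | t < n] | k < l + m].

(** The observed outputs [y] stand in for the unobservable head signals; the price is head noise
    amplified by [G]. *)
Definition predicted_mean (y : l.-tuple (n.-tuple R[i])) (k : 'I_m) (t : 'I_n) :=
  kap k t + \sum_j G k j * tnth (tnth y j) t.

(** The summand [0], like the factor [1%:C] in the tail, is kept so that the map is literally the
    second one of [law_change_block]. *)
Definition reference_head (u : l.-tuple (n.-tuple R[i])) :
    l.-tuple (n.-tuple R[i]) :=
  [tuple [tuple 0 + s%:C%C * tnth (tnth u k) t | t < n] | k < l].

Definition reference_tail (y : l.-tuple (n.-tuple R[i]))
    (v : m.-tuple (n.-tuple R[i])) : m.-tuple (n.-tuple R[i]) :=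
  [tuple [tuple predicted_mean y k t + 1%:C%C * tnth (tnth v k) t | t < n] | k < m].

Definition reference_output (u : l.-tuple (n.-tuple R[i]))
    (v : m.-tuple (n.-tuple R[i])) : (l + m).-tuple (n.-tuple R[i]) :=
  [tuple of reference_head u ++ reference_tail (reference_head u) v].

Definition head_ratio (u : l.-tuple (n.-tuple R[i])) : R :=
  \prod_(k < l) \prod_(t < n)
    cgauss_ratio s (a (lshift m k) t) 0 (tnth (tnth u k) t).

Definition tail_ratio (y : l.-tuple (n.-tuple R[i]))
    (v : m.-tuple (n.-tuple R[i])) : R :=
  \prod_(k < m) \prod_(t < n)
    cgauss_ratio 1 (a (rshift l k) t) (predicted_mean y k t) (tnth (tnth v k) t).

Definition clean_head (u : l.-tuple (n.-tuple R[i])) :=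
  [tuple [tuple a (lshift m k) t + tnth (tnth u k) t | t < n] | k < l].
Definition clean_tail (v : m.-tuple (n.-tuple R[i])) :=
  [tuple [tuple a (rshift l k) t + tnth (tnth v k) t | t < n] | k < m].

Lemma noisy_output_cat (u : l.-tuple (n.-tuple R[i])) (v : m.-tuple (n.-tuple R[i])) :
  noisy_output [tuple of u ++ v] = [tuple of clean_head u ++ clean_tail v].
Proof.
apply/eq_from_tnth => i; rewrite tnth_mktuple; case: (split_ordP i) => k ->.
  by rewrite !tnth_lshift tnth_mktuple.
by rewrite !tnth_rshift tnth_mktuple.
Qed.

Lemma measurable_entry k (i : 'I_k) (t : 'I_n) :
  measurable_fun [set: k.-tuple (n.-tuple R[i])] (fun z => tnth (tnth z i) t).
Proof. exact: (measurableT_comp (measurable_tnth t) (measurable_tnth i)). Qed.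

Lemma measurable_table d (X : measurableType d) k (f : 'I_k -> 'I_n -> X -> R[i]) :
  (forall i t, measurable_fun setT (f i t)) ->
  measurable_fun [set: X] (fun x => [tuple [tuple f i t x | t < n] | i < k]).
Proof.
move=> mf; apply/measurable_fun_tnthP => i; apply/measurable_fun_tnthP => t.
rewrite (_ : _ \o _ = f i t)//.
by apply/funext => x /=; rewrite !tnth_mktuple.
Qed.

Lemma measurable_noisy_output : measurable_fun setT noisy_output.
Proof.
apply: measurable_table => k t; apply: measurable_complexD => //.
exact: measurable_entry.
Qed.

Lemma measurable_predicted_mean d (X : measurableType d) (g : X -> l.-tuple (n.-tuple R[i])) k t :
  measurable_fun setT g -> measurable_fun setT (fun x => predicted_mean (g x) k t).
Proof.
move=> mg; apply: measurable_complexD => //; apply: measurable_complex_sum => j.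
apply: measurable_complexM => //.
exact: (measurableT_comp (measurable_entry j t) mg).
Qed.

Lemma measurable_reference_tail :
  measurable_fun setT (fun p : l.-tuple (n.-tuple R[i]) * m.-tuple (n.-tuple R[i]) =>
    reference_tail p.1 p.2).
Proof.
apply: measurable_table => k t; apply: measurable_complexD.
  exact: measurable_predicted_mean.
apply: measurable_complexM => //.
exact: (measurableT_comp (measurable_entry k t) measurable_snd).
Qed.

Lemma measurable_cgauss_ratio d (X : measurableType d) (r : R) (c : R[i]) (b z : X -> R[i]) :
  measurable_fun setT b -> measurable_fun setT z ->
  measurable_fun setT (fun x => cgauss_ratio r c (b x) (z x)).
Proof.
move=> mb mz; apply: measurable_funM => //; apply: measurableT_comp => //.
apply: measurable_funB; first exact: measurable_normsq.
apply: measurable_funM => //; apply: measurable_normsq.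
apply: measurable_complexD; first exact: measurable_complexD.
rewrite (_ : (fun _ => _) = fun x => - 1 * b x); last first.
  by apply/funext => x; rewrite mulN1r.
exact: measurable_complexM.
Qed.

Lemma measurable_head_ratio : measurable_fun setT head_ratio.
Proof.
apply: measurable_prod => k _; apply: measurable_prod => t _.
by apply: measurable_cgauss_ratio => //; exact: measurable_entry.
Qed.

Lemma measurable_tail_ratio :
  measurable_fun setT (fun p : l.-tuple (n.-tuple R[i]) * m.-tuple (n.-tuple R[i]) =>
    tail_ratio p.1 p.2).
Proof.
apply: measurable_prod => k _; apply: measurable_prod => t _.
apply: measurable_cgauss_ratio; first exact: measurable_predicted_mean.
exact: (measurableT_comp (measurable_entry k t) measurable_snd).
Qed.

Lemma head_ratio_ge0 u : 0 <= head_ratio u.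
Proof. by apply: prodr_ge0 => k _; apply: prodr_ge0 => t _; exact: cgauss_ratio_ge0. Qed.

Lemma tail_ratio_ge0 y v : 0 <= tail_ratio y v.
Proof. by apply: prodr_ge0 => k _; apply: prodr_ge0 => t _; exact: cgauss_ratio_ge0. Qed.

(** For a fixed head output the tail change is a mere translation of the means, so the tail is
    integrated out first. What remains is a function [H] of the head output alone, to which the head
    change applies. The tail weight is taken at [clean_head u] because the prediction is made from
    the head output actually observed. *)
Lemma integral_tilting (f : (l + m).-tuple (n.-tuple R[i]) -> \bar R) :
  measurable_fun setT f -> (forall y, 0 <= f y)%E ->
  (\int[noise l]_u \int[noise m]_v
      (f (noisy_output [tuple of u ++ v]) *
       (head_ratio u * tail_ratio (clean_head u) v)%:E) =
   \int[noise l]_u \int[noise m]_v f (reference_output u v))%E.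
Proof.
move=> mf f0.
have s0 : 0 < s by rewrite (lt_le_trans ltr01).
have [_ _ _ _ Eh] := law_change_block (fun k t => a (lshift m k) t) (fun _ _ => 0) s0.
pose H (y : l.-tuple (n.-tuple R[i])) := (\int[noise m]_v f [tuple of y ++ reference_tail y v])%E.
have mfc (y : l.-tuple (n.-tuple R[i])) : measurable_fun [set: m.-tuple (n.-tuple R[i])]
    (fun v => f [tuple of y ++ v]).
  apply: (measurableT_comp mf).
  exact: (measurableT_comp (@measurable_cat_tuple _ (n.-tuple R[i]) l m)
    (pair1_measurable y)).
have mH : measurable_fun setT H.
  pose h (p : l.-tuple (n.-tuple R[i]) * m.-tuple (n.-tuple R[i])) :=
    f [tuple of p.1 ++ reference_tail p.1 p.2].
  have mh : measurable_fun setT h.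
    apply: (measurableT_comp mf).
    pose q (p : l.-tuple (n.-tuple R[i]) * m.-tuple (n.-tuple R[i])) :=
      (p.1, reference_tail p.1 p.2).
    have mq : measurable_fun setT q.
      apply/measurable_fun_pairP; split; first exact: measurable_fst.
      exact: measurable_reference_tail.
    exact: (measurableT_comp (@measurable_cat_tuple _ (n.-tuple R[i]) l m) mq).
  exact: (@measurable_fun_fubini_tonelli_F _ _ _ _ _ (noise m) h mh (fun p => f0 _)).
have H0 y : (0 <= H y)%E by exact: integral_ge0.
rewrite -[RHS]/(\int[noise l]_u H (reference_head u))%E -Eh//.
apply: eq_integral => u _; rewrite -/(clean_head u) -/(head_ratio u).
have [_ _ mW W0 Et] := law_change_block (fun k t => a (rshift l k) t)
  (predicted_mean (clean_head u)) (@ltr01 R).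
rewrite /H -(Et (fun v => f [tuple of clean_head u ++ v]))// -ge0_integralZr//.
- apply: eq_integral => v _; rewrite noisy_output_cat -muleA; congr (_ * _)%E.
  by rewrite -EFinM mulrC.
- apply: emeasurable_funM; last exact/measurable_EFinP.
  apply: (measurableT_comp (mfc (clean_head u))).
  by apply: measurable_table => k t; apply: measurable_complexD => //; exact: measurable_entry.
- by move=> v _; rewrite mule_ge0// lee_fin; exact: W0.
- by rewrite lee_fin; exact: head_ratio_ge0.
Qed.

End tilting.

(** * Lower bounds on the likelihood ratios, and the converse for one library *)

Section ratio_bounds.
Variable R : realType.

Lemma cgauss_ratioE (s : R) (a b z : R[i]) : 0 < s ->
  cgauss_ratio s a b z =
  expR (normsq z - normsq (a + z - b) / s ^+ 2 - ln (s ^+ 2)).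
Proof.
move=> s0; rewrite /cgauss_ratio [in RHS]expRD mulrC; congr (_ * _).
by rewrite expRN lnK// posrE exprn_gt0.
Qed.

(** The favourable term [normsq z] is dropped. The quotient of [normsq a] by [s ^+ 2] is kept, as
    the signal energy will be of order [s ^+ 2]; for the noise part, [1 <= s] allows the quotient to
    be dropped. *)
Lemma cgauss_ratio_head_ge (s : R) (a z : R[i]) : 1 <= s ->
  expR (- (ln (s ^+ 2) + 2 * (normsq a / s ^+ 2) + 2 * normsq z)) <=
  cgauss_ratio s a 0 z.
Proof.
move=> s1; have s0 : 0 < s by rewrite (lt_le_trans ltr01).
rewrite cgauss_ratioE// ler_expR subr0.
have s2 : 0 < s ^+ 2 by rewrite exprn_gt0.
have h1 : normsq (a + z) / s ^+ 2 <= 2 * (normsq a / s ^+ 2) + 2 * normsq z / s ^+ 2.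
  by rewrite mulrA -mulrDl ler_pM2r ?invr_gt0//; exact: normsqD.
have h2 : 2 * normsq z / s ^+ 2 <= 2 * normsq z.
  rewrite ler_pdivrMr// ler_peMr ?mulr_ge0 ?normsq_ge0//.
  by rewrite exprn_ege1.
have := normsq_ge0 z; lra.
Qed.

(** The difference of means [e] will be a combination of head noises, so that the bound involves
    neither the signal nor the power. *)
Lemma cgauss_ratio_tail_ge (a b z e : R[i]) : a - b = - e ->
  expR (- (2 * normsq z + 2 * normsq e)) <= cgauss_ratio 1 a b z.
Proof.
move=> abe; rewrite cgauss_ratioE// ler_expR expr1n ln1 divr1 subr0.
have -> : a + z - b = z - e by rewrite addrAC abe addrC.
have := normsqB z e; have := normsq_ge0 z; lra.
Qed.

End ratio_bounds.

Section codeword.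
Variables (R : realType) (l m n : nat) (s : R).
Variables (a : 'I_(l + m) -> 'I_n -> R[i]) (kap : 'I_m -> 'I_n -> R[i]).
Variable G : 'I_m -> 'I_l -> R[i].
Hypothesis s1 : 1 <= s.
Hypothesis aE : forall k t,
  a (rshift l k) t = kap k t + \sum_j G k j * a (lshift m j) t.

Let noise k := iid_law (iid_law (cnormal01 R) n) k.

Definition energy k (z : k.-tuple (n.-tuple R[i])) : R :=
  \sum_(i < k) \sum_(t < n) normsq (tnth (tnth z i) t).

(** The first [2] pays for the noise of a symbol itself, the other term for head noise propagated
    through [G]; its factor [l] is the Cauchy-Schwarz loss of [normsq_sum]. *)
Definition gain_const : R :=
  2 + 2 * l%:R * \sum_(k < m) \sum_(j < l) normsq (G k j).

(** The noise-free part of minus the logarithm of the head ratio; the tail contributes nothing to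
    it. *)
Definition signal_cost : R :=
  (l * n)%:R * ln (s ^+ 2) +
  2 * ((\sum_(k < l) \sum_(t < n) normsq (a (lshift m k) t)) / s ^+ 2).

Lemma energy_ge0 k (z : k.-tuple (n.-tuple R[i])) : 0 <= energy z.
Proof. by do 2 (apply: sumr_ge0 => ? _); exact: normsq_ge0. Qed.

Lemma energy_cat (u : l.-tuple (n.-tuple R[i])) (v : m.-tuple (n.-tuple R[i])) :
  energy [tuple of u ++ v] = energy u + energy v.
Proof.
rewrite /energy big_split_ord; congr (_ + _); apply: eq_bigr => k _.
  by rewrite tnth_lshift.
by rewrite tnth_rshift.
Qed.

Lemma gain_const_ge0 : 0 <= gain_const.
Proof.
rewrite addr_ge0// !mulr_ge0//; do 2 (apply: sumr_ge0 => ? _); exact: normsq_ge0.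
Qed.

Lemma signal_cost_ge0 : 0 <= signal_cost.
Proof.
rewrite addr_ge0// !mulr_ge0//.
- by rewrite ln_ge0// exprn_ege1.
- by do 2 (apply: sumr_ge0 => ? _); exact: normsq_ge0.
- by rewrite invr_ge0 sqr_ge0.
Qed.

Lemma prod_expR_le k (f g : 'I_k -> 'I_n -> R) :
  (forall i t, expR (- f i t) <= g i t) ->
  expR (- \sum_(i < k) \sum_(t < n) f i t) <= \prod_(i < k) \prod_(t < n) g i t.
Proof.
move=> fg; rewrite -sumrN expR_sum; apply: ler_prod => i _.
rewrite expR_ge0/= -sumrN expR_sum; apply: ler_prod => t _.
by rewrite expR_ge0/=.
Qed.

Lemma ratio_ge (u : l.-tuple (n.-tuple R[i])) (v : m.-tuple (n.-tuple R[i])) :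
  expR (- (signal_cost + gain_const * energy [tuple of u ++ v])) <=
  head_ratio s a u * tail_ratio a kap G (clean_head a u) v.
Proof.
pose fh k t : R := ln (s ^+ 2) + 2 * (normsq (a (lshift m k) t) / s ^+ 2) +
  2 * normsq (tnth (tnth u k) t).
pose ft k t : R := 2 * normsq (tnth (tnth v k) t) +
  2 * (l%:R * \sum_j normsq (G k j) * normsq (tnth (tnth u j) t)).
have hh : expR (- \sum_(k < l) \sum_(t < n) fh k t) <= head_ratio s a u.
  by apply: prod_expR_le => k t; exact: cgauss_ratio_head_ge.
have ht : expR (- \sum_(k < m) \sum_(t < n) ft k t) <=
    tail_ratio a kap G (clean_head a u) v.
  apply: prod_expR_le => k t.
  (* By [aE] the noiseless terms of the true and predicted tail means cancel, leaving [- e], the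
     head noise seen through [G]. *)
  pose e := \sum_j G k j * tnth (tnth u j) t.
  apply: le_trans (cgauss_ratio_tail_ge (e := e) _ _).
    rewrite ler_expR lerN2 lerD2l ler_pM2l//.
    apply: le_trans (normsq_sum _) _.
    by under eq_bigr do rewrite normsqM.
  rewrite /predicted_mean aE; apply/eqP.
  rewrite opprD addrACA subrr add0r subr_eq addrC -subr_eq opprK -big_split/=.
  by apply/eqP; apply: eq_bigr => j _; rewrite !tnth_mktuple mulrDr.
apply: le_trans (ler_pM (expR_ge0 _) (expR_ge0 _) hh ht).
rewrite -expRD ler_expR -opprD lerN2 energy_cat.
have -> : \sum_(k < l) \sum_(t < n) fh k t = signal_cost + 2 * energy u.
  rewrite /fh /signal_cost /energy.
  under eq_bigr do rewrite !big_split/= sumr_const card_ord.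
  rewrite !big_split/= sumr_const card_ord.
  congr (_ + _ + _).
  - by rewrite -mulrnA [RHS]mulr_natl mulnC.
  - rewrite mulr_suml mulr_sumr; apply: eq_bigr => k _.
    by rewrite mulr_suml mulr_sumr.
  - by rewrite mulr_sumr; apply: eq_bigr => k _; rewrite mulr_sumr.
have -> : \sum_(k < m) \sum_(t < n) ft k t = 2 * energy v +
    2 * (l%:R * \sum_(k < m) \sum_(j < l) normsq (G k j) *
       \sum_(t < n) normsq (tnth (tnth u j) t)).
  rewrite /ft /energy; under eq_bigr do rewrite big_split/= -!mulr_sumr.
  rewrite big_split/= -!mulr_sumr; congr (_ + _ * (_ * _)).
  apply: eq_bigr => k _; rewrite exchange_big/=.
  by apply: eq_bigr => j _; rewrite mulr_sumr.
have hG : \sum_(k < m) \sum_(j < l) normsq (G k j) *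
       \sum_(t < n) normsq (tnth (tnth u j) t) <=
    (\sum_(k < m) \sum_(j < l) normsq (G k j)) * energy u.
  rewrite mulr_suml; apply: ler_sum => k _; rewrite mulr_suml; apply: ler_sum => j _.
  apply: ler_wpM2l; first exact: normsq_ge0.
  rewrite /energy (bigD1 j)//= lerDl.
  by do 2 (apply: sumr_ge0 => ? _); exact: normsq_ge0.
have G0 : 0 <= \sum_(k < m) \sum_(j < l) normsq (G k j).
  by do 2 (apply: sumr_ge0 => ? _); exact: normsq_ge0.
have := ler_wpM2l (ler0n R l) hG.
have h0 : 0 <= l%:R * (\sum_(k < m) \sum_(j < l) normsq (G k j)) * energy v.
  by rewrite !mulr_ge0// energy_ge0.
rewrite /gain_const; lra.
Qed.

Lemma measurable_energy k :
  measurable_fun setT (@energy k).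
Proof.
apply: measurable_sum => i; apply: measurable_sum => t.
by apply: measurable_normsq; exact: measurable_entry.
Qed.

Lemma integral_energy k : (\int[noise k]_z (energy z)%:E <= (4 * (k * n))%:R%:E)%E.
Proof.
have mE i t : measurable_fun setT (fun z : k.-tuple (n.-tuple R[i]) =>
    (normsq (tnth (tnth z i) t))%:E).
  by apply/measurable_EFinP; apply: measurable_normsq; exact: measurable_entry.
have -> : (\int[noise k]_z (energy z)%:E =
    \sum_(i < k) \sum_(t < n) \int[noise k]_z (normsq (tnth (tnth z i) t))%:E)%E.
  rewrite /energy; under eq_integral do rewrite -sumEFin.
  rewrite ge0_integral_sum//.
  - apply: eq_bigr => i _; under eq_integral do rewrite -sumEFin.
    by rewrite ge0_integral_sum// => t z _; rewrite lee_fin normsq_ge0.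
  - move=> i; apply/measurable_EFinP; apply: measurable_sum => t.
    by apply: measurable_normsq; exact: measurable_entry.
  - move=> i z _; rewrite lee_fin; apply: sumr_ge0 => t _; exact: normsq_ge0.
have H i t : (\int[noise k]_z (normsq (tnth (tnth z i) t))%:E <= 4%:E)%E.
  have mn : measurable_fun setT (fun y : n.-tuple R[i] => (normsq (tnth y t))%:E).
    apply/measurable_EFinP; apply: measurable_normsq; exact: measurable_tnth.
  rewrite (@integral_iid_tnth _ _ _ _ k i (fun y => (normsq (tnth y t))%:E))//; last first.
    by move=> y; rewrite lee_fin normsq_ge0.
  rewrite (@integral_iid_tnth _ _ _ _ n t (fun y => (normsq y)%:E))//.
  - exact: integral_normsq_cnormal.
  - by apply/measurable_EFinP; exact: measurable_normsq.
  - by move=> y; rewrite lee_fin normsq_ge0.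
apply: (@le_trans _ _ (\sum_(i < k) \sum_(t < n) 4%:E)%E).
  by do 2 (apply: lee_sum => ? _).
rewrite (eq_bigr (fun=> (n%:R * 4)%:E)); last first.
  by move=> i _; rewrite sumEFin sumr_const card_ord mulr_natl.
rewrite sumEFin sumr_const card_ord lee_fin -(mulr_natr _ k) !natrM; lra.
Qed.

(* With [x] the log-likelihood ratio, [ln c <= x + c * expR (- x)] on [E]; the mean of
   [x] is bounded by [signal_cost] plus a multiple of the noise energy. *)
Lemma codeword_bound (E : set ((l + m).-tuple (n.-tuple R[i]))) (c q B : R) :
  measurable E -> 0 < c -> 0 <= q -> 0 <= B -> B <= ln c + q ->
  (B%:E * noise (l + m) (noisy_output a @^-1` E) <=
   (q + signal_cost + gain_const * (4 * ((l + m) * n))%:R)%:E +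
   c%:E * \int[noise l]_u \int[noise m]_v
     (\1_E (reference_output s kap G u v))%:E)%E.
Proof.
move=> mE c0 q0 B0 Bc.
pose X := (l.-tuple (n.-tuple R[i]) * m.-tuple (n.-tuple R[i]))%type.
pose Q : probability X R := (noise l \x noise m)%E.
pose ct (p : X) : (l + m).-tuple (n.-tuple R[i]) := [tuple of p.1 ++ p.2].
have mct : measurable_fun setT ct by exact: measurable_cat_tuple.
have mny : measurable_fun setT (noisy_output a) by exact: measurable_noisy_output.
have intQ (g : (l + m).-tuple (n.-tuple R[i]) -> \bar R) : measurable_fun setT g ->
    (forall z, 0 <= g z)%E -> (\int[noise (l + m)]_z g z = \int[Q]_p g (ct p))%E.
  move=> mg g0; rewrite [LHS]integral_iid_cat//.
  rewrite (@fubini_tonelli1 _ _ _ _ _ (noise l) (noise m) (g \o ct))//.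
    exact: (measurableT_comp mg mct).
  by move=> p; exact: g0.
pose rho (p : X) := head_ratio s a p.1 * tail_ratio a kap G (clean_head a p.1) p.2.
have mch : measurable_fun setT (clean_head a).
  apply: measurable_table => k t; apply: measurable_complexD => //.
  exact: measurable_entry.
have mrho : measurable_fun setT rho.
  apply: measurable_funM.
    exact: (measurableT_comp (measurable_head_ratio s a) measurable_fst).
  pose h (p : X) := (clean_head a p.1, p.2).
  have mh : measurable_fun setT h.
    apply/measurable_fun_pairP; split; last exact: measurable_snd.
    exact: (measurableT_comp mch measurable_fst).
  exact: (measurableT_comp (measurable_tail_ratio a kap G) mh).
have rho0 p : 0 <= rho p.
  by apply: mulr_ge0; [exact: head_ratio_ge0|exact: tail_ratio_ge0].
have m1E : measurable_fun setT (fun y => (\1_E y : R)%:E).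
  by apply/measurable_EFinP; exact: measurable_indic.
have m1 : measurable_fun setT (fun p => (\1_E (noisy_output a (ct p)) : R)%:E).
  exact: (measurableT_comp m1E (measurableT_comp mny mct)).
have mpre : measurable (noisy_output a @^-1` E).
  by rewrite -[X in measurable X]setTI; exact: mny.
have tilt : (\int[noise l]_u \int[noise m]_v (\1_E (reference_output s kap G u v))%:E =
    \int[Q]_p ((\1_E (noisy_output a (ct p)))%:E * (rho p)%:E))%E.
  have f0 (y : (l + m).-tuple (n.-tuple R[i])) : (0 <= (\1_E y : R)%:E)%E.
    by rewrite lee_fin.
  apply: etrans; first exact: (esym (integral_tilting a kap G s1 m1E f0)).
  rewrite (@fubini_tonelli1 _ _ _ _ _ (noise l) (noise m)
    (fun p => (\1_E (noisy_output a (ct p)))%:E * (rho p)%:E)%E)//.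
    by apply: emeasurable_funM => //; exact/measurable_EFinP.
  by move=> p; rewrite mule_ge0 ?lee_fin.
(* By [ratio_ge], [V - q] dominates minus the logarithm of [rho]; as it is affine in the energy, its
   mean is explicit. *)
pose V (z : (l + m).-tuple (n.-tuple R[i])) := q + signal_cost + gain_const * energy z.
have V0 z : 0 <= V z.
  apply: addr_ge0; first by apply: addr_ge0 => //; exact: signal_cost_ge0.
  by apply: mulr_ge0; [exact: gain_const_ge0|exact: energy_ge0].
have mV : measurable_fun setT (fun z => (V z)%:E).
  apply/measurable_EFinP; apply: measurable_funD => //; apply: measurable_funM => //.
  exact: measurable_energy.
have mVct : measurable_fun setT (fun p => (V (ct p))%:E).
  exact: (measurableT_comp mV mct).
have m1r : measurable_fun setT (fun p => (\1_E (noisy_output a (ct p)))%:E * (rho p)%:E)%E.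
  by apply: emeasurable_funM => //; exact/measurable_EFinP.
have intV : (\int[Q]_p (V (ct p))%:E <=
    (q + signal_cost + gain_const * (4 * ((l + m) * n))%:R)%:E)%E.
  rewrite -(intQ (fun z => (V z)%:E))//.
  under eq_integral do rewrite EFinD EFinM.
  have mGE : measurable_fun setT (fun z => (@energy (l + m) z)%:E).
    by apply/measurable_EFinP; exact: measurable_energy.
  have sc0 : (0 <= (q + signal_cost)%:E)%E.
    by rewrite lee_fin; apply: addr_ge0 => //; exact: signal_cost_ge0.
  have gc0 : (0 <= gain_const%:E)%E by rewrite lee_fin; exact: gain_const_ge0.
  have en0 z : (0 <= (@energy (l + m) z)%:E)%E by rewrite lee_fin; exact: energy_ge0.
  rewrite ge0_integralD//=; last 2 first.
  - by move=> z _; exact: mule_ge0.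
  - exact: emeasurable_funM.
  rewrite [in leRHS]EFinD; apply: leeD.
    by rewrite [leLHS]integral_probability_cst.
  rewrite ge0_integralZl//.
  rewrite EFinM; apply: lee_wpmul2l; first exact: gc0.
  exact: integral_energy.
have -> : (B%:E * noise (l + m) (noisy_output a @^-1` E) =
    \int[Q]_p (B * \1_E (noisy_output a (ct p)))%:E)%E.
  have m1n : measurable_fun setT (fun z => (\1_E (noisy_output a z) : R)%:E).
    exact: (measurableT_comp m1E mny).
  have mB : measurable_fun setT (fun z => (B * \1_E (noisy_output a z) : R)%:E).
    by apply/measurable_EFinP; apply: measurable_funM => //; exact/measurable_EFinP.
  have B10 (z : (l + m).-tuple (n.-tuple R[i])) :
      (0 <= (B * \1_E (noisy_output a z) : R)%:E)%E.
    by rewrite lee_fin mulr_ge0.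
  rewrite -(intQ _ mB B10).
  under [RHS]eq_integral do rewrite EFinM.
  rewrite ge0_integralZl//.
  by congr (_ * _)%E; rewrite -[X in noise _ X]setIT -integral_indic.
rewrite tilt -ge0_integralZl//; last 2 first.
- by move=> p _; rewrite mule_ge0 ?lee_fin.
- by rewrite lee_fin ltW.
apply: le_trans (leeD intV (lexx _)).
rewrite -ge0_integralD//; last 3 first.
- by move=> p _; rewrite lee_fin.
- by move=> p _; rewrite !mule_ge0 ?lee_fin// ltW.
- exact: emeasurable_funM.
apply: ge0_le_integral => //.
- by move=> p _; rewrite lee_fin mulr_ge0.
- by apply/measurable_EFinP; apply: measurable_funM => //; exact/measurable_EFinP.
- by apply: emeasurable_funD => //; exact: emeasurable_funM.
move=> p _; rewrite -!EFinM -EFinD lee_fin.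
(* Off [E] the left side vanishes and the right side is [V], nonnegative because [q] is. *)
have [yE|yE] := boolP (noisy_output a (ct p) \in E); last first.
  by rewrite indicE (negbTE yE) !(mulr0, mul0r) addr0.
rewrite indicE yE mulr1 mul1r.
have lb : expR (- (V (ct p) - q)) <= rho p.
  have := ratio_ge p.1 p.2; rewrite /rho; apply: le_trans.
  by rewrite ler_expR /V; lra.
have := ler_wpM2l (ltW c0) lb.
have -> : c * expR (- (V (ct p) - q)) = expR (ln c - (V (ct p) - q)).
  by rewrite expRD lnK.
have := expR_ge1Dx (ln c - (V (ct p) - q)); lra.
Qed.

End codeword.

(** * Averaging over the library *)

Lemma measurable_reference_output (R : realType) (l m n : nat) (s : R)
    (kap : 'I_m -> 'I_n -> R[i]) (G : 'I_m -> 'I_l -> R[i]) :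
  measurable_fun setT (fun p : l.-tuple (n.-tuple R[i]) * m.-tuple (n.-tuple R[i]) =>
    reference_output s kap G p.1 p.2).
Proof.
have mrh : measurable_fun setT (@reference_head R l n s).
  apply: measurable_table => k t; apply: measurable_complexD => //.
  by apply: measurable_complexM => //; exact: measurable_entry.
pose X := (l.-tuple (n.-tuple R[i]) * m.-tuple (n.-tuple R[i]))%type.
have mrh1 : measurable_fun setT (fun p : X => reference_head s p.1).
  exact: (measurableT_comp mrh measurable_fst).
pose h (p : X) := (reference_head s p.1, p.2).
have mh : measurable_fun setT h.
  by apply/measurable_fun_pairP; split; [exact: mrh1|exact: measurable_snd].
pose h' (p : X) := (reference_head s p.1, reference_tail kap G (reference_head s p.1) p.2).
have mh' : measurable_fun setT h'.
  apply/measurable_fun_pairP; split; first exact: mrh1.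
  exact: (measurableT_comp (measurable_reference_tail kap G) mh).
exact: (measurableT_comp (@measurable_cat_tuple _ (n.-tuple R[i]) l m) mh').
Qed.

Section averaging.
Variables (R : realType) (N L l m n : nat) (s : R).
Notation W := (library N L).
Variables (D : 'I_(l + m) -> 'I_N) (a : W -> 'I_(l + m) -> 'I_n -> R[i]).
Variables (kap : W -> 'I_m -> 'I_n -> R[i]) (G : 'I_m -> 'I_l -> R[i]).
Variable dec : 'I_(l + m) -> n.-tuple R[i] -> file L.
Variables (I : finType) (e : I -> rel W).
Hypothesis s1 : 1 <= s.
Hypothesis Dinj : injective D.
Hypothesis aE : forall F k t,
  a F (rshift l k) t = kap F k t + \sum_j G k j * a F (lshift m j) t.
Hypothesis mdec : forall k f, measurable [set y | dec k y = f].
Hypothesis e_refl : forall i, reflexive (e i).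
Hypothesis e_sym : forall i, symmetric (e i).
Hypothesis e_trans : forall i, transitive (e i).
Hypothesis kapE : forall F F' : W, (forall i, e i F F') ->
  (forall x, (forall k, x != D (rshift l k)) -> F x = F' x) -> kap F =2 kap F'.

Let noise k := iid_law (iid_law (cnormal01 R) n) k.

(** Each [e i] stands for equality of the [i]-th piece of side information. Relations on libraries
    let messages and cached contents, of different types, share one index type; the product over [i]
    is the product of the marginals. *)
Definition side_weight (F : W) : R :=
  \prod_(i : I) (#|[pred F' | e i F F']|%:R / #|{: W}|%:R).

Definition decoded (F : W) : set ((l + m).-tuple (n.-tuple R[i])) :=
  [set y | forall k, dec k (tnth y k) = F (D k)].

Definition row_error (F : W) (k : 'I_(l + m)) : \bar R :=
  iid_law (cnormal01 R) n
    [set z | dec k [tuple a F k t + tnth z t | t < n] != F (D k)].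

Definition overwrite (F : W) (g : {ffun 'I_(l + m) -> file L}) : W :=
  [ffun x => if [pick k | D k == x] is Some k then g k else F x].

Lemma overwriteD F g k : overwrite F g (D k) = g k.
Proof.
rewrite ffunE; case: pickP => [k' /eqP/Dinj -> //|/(_ k)].
by rewrite eqxx.
Qed.

Lemma overwrite_out F g x : (forall k, x != D k) -> overwrite F g x = F x.
Proof. by move=> xD; rewrite ffunE; case: pickP => // k; rewrite eq_sym (negbTE (xD k)). Qed.

Lemma card_library_gt0 : (0 < #|{: W}|)%N.
Proof. by apply/card_gt0P; exists [ffun=> Ordinal (expn_gt0 2 L : 0 < 2 ^ L)%N]. Qed.

Section fixed_noise.
Variables (u : l.-tuple (n.-tuple R[i])) (v : m.-tuple (n.-tuple R[i])).

Let ok F := `[< decoded F (reference_output s (kap F) G u v) >].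

(* The side information, the files outside the demand and the noise determine the
   decoded files: first the head decoders, then, through [kapE], the tail ones. *)
Lemma ok_inj (H : {ffun I -> W}) F F' : ok F -> ok F' ->
  (forall i, e i F (H i)) -> (forall i, e i F' (H i)) ->
  (forall x, (forall k, x != D k) -> F x = F' x) -> F = F'.
Proof.
move=> /asboolP okF /asboolP okF' eF eF' FF'.
have eFF' i : e i F F' by apply: e_trans (eF i) _; rewrite e_sym.
have FFl k : F (D (lshift m k)) = F' (D (lshift m k)).
  by rewrite -okF -okF' /reference_output !tnth_lshift.
have FFh x : (forall k, x != D (rshift l k)) -> F x = F' x.
  move=> xD; have [/existsP[k /eqP ->]|/existsPn xl] :=
      boolP [exists k, x == D (lshift m k)]; first exact: FFl.
  by apply: FF' => k; case: (split_ordP k) => j ->.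
have kk : kap F = kap F'.
  apply/funext => k; apply/funext => t; exact: kapE.
apply/ffunP => x; have [/existsP[k /eqP ->]|/existsPn xr] :=
    boolP [exists k, x == D (rshift l k)]; last exact: FFh.
by rewrite -okF -okF' kk.
Qed.

(* [side_weight F] is the probability that independent uniform libraries [H i] have
   the same side information as [F]; for fixed [H], overwriting the demanded files
   of an admissible [F] in all possible ways is injective. *)
Lemma sum_side_weight_ok :
  (2 ^ (L * (l + m)))%:R * \sum_(F : W) side_weight F * (ok F)%:R <= #|{: W}|%:R.
Proof.
set w := #|{: W}|%:R : R.
have w0 : 0 < w by rewrite ltr0n card_library_gt0.
have -> : \sum_(F : W) side_weight F * (ok F)%:R =
    (w ^+ #|I|)^-1 * \sum_(H : {ffun I -> W})
      #|[pred F | ok F && [forall i, e i F (H i)]]|%:R.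
  transitivity (\sum_(F : W) \sum_(H : {ffun I -> W})
      (w ^+ #|I|)^-1 * (ok F && [forall i, e i F (H i)])%:R).
    apply: eq_bigr => F _; rewrite /side_weight.
    under eq_bigr => i _.
      rewrite -sum1_card natr_sum big_mkcond/= mulr_suml; over.
    rewrite bigA_distr_bigA/= mulr_suml; apply: eq_bigr => H _.
    have [/forallP eH|/forallPn[i eH]] := boolP [forall i, e i F (H i)]; last first.
      rewrite andbF mulr0; apply/eqP; rewrite mulf_eq0; apply/orP; left.
      apply/eqP; rewrite (bigD1 i)//= inE (negbTE eH) !mul0r//.
    rewrite andbT; congr (_ * _); under eq_bigr => i _.
      rewrite inE eH mul1r; over.
    by rewrite prodr_const exprVn cardE/=.
  rewrite exchange_big/= mulr_sumr; apply: eq_bigr => H _.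
  rewrite -mulr_sumr; congr (_ * _).
  rewrite -sum1_card natr_sum [in RHS]big_mkcond/=.
  by apply: eq_bigr => F _; rewrite inE; case: ifP.
have cnt (H : {ffun I -> W}) :
    (2 ^ (L * (l + m)))%:R * #|[pred F | ok F && [forall i, e i F (H i)]]|%:R <= w :> R.
  rewrite -natrM ler_nat.
  pose A : {set W} := finset (fun F => ok F && [forall i, e i F (H i)]).
  have -> : #|[pred F | ok F && [forall i, e i F (H i)]]| = #|A|.
    by apply: eq_card => F; rewrite !inE.
  have -> : (2 ^ (L * (l + m)) = #|(finset.setT : {set {ffun 'I_(l + m) -> file L}})|)%N.
    by rewrite cardsT card_ffun !card_ord expnM.
  rewrite -cardsX -(card_in_imset (f := fun p => overwrite p.2 p.1)).
    exact: max_card.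
  move=> [g F] [g' F']; rewrite !inE/= => /andP[okF /forallP eF] /andP[okF' /forallP eF'] E.
  have gg : g = g'.
    by apply/ffunP => k; rewrite -(overwriteD F g k) E overwriteD.
  congr (_, _) => //; apply: (ok_inj okF okF' eF eF') => x xD.
  by rewrite -(overwrite_out F g xD) E overwrite_out.
rewrite mulrCA ler_pdivrMl ?exprn_gt0// mulr_sumr.
apply: (@le_trans _ _ (\sum_(H : {ffun I -> W}) w)); first exact: ler_sum.
by rewrite sumr_const card_ffun -[w *+ _]mulr_natl natrX.
Qed.

End fixed_noise.

Lemma side_weight_gt0 F : 0 < side_weight F.
Proof.
apply: prodr_gt0 => i _; rewrite divr_gt0// ltr0n ?card_library_gt0//.
by apply/card_gt0P; exists F; rewrite inE e_refl.
Qed.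

Lemma side_weight_le1 F : side_weight F <= 1.
Proof.
apply: prodr_ile1 => i _; rewrite divr_ge0//= ler_pdivrMr ?ltr0n ?card_library_gt0//.
by rewrite mul1r ler_nat max_card.
Qed.

Lemma measurable_row_decoded F k :
  measurable [set z : n.-tuple R[i] |
    dec k [tuple a F k t + tnth z t | t < n] = F (D k)].
Proof.
have mt : measurable_fun setT
    (fun z : n.-tuple R[i] => [tuple a F k t + tnth z t | t < n]).
  apply/measurable_fun_tnthP => t.
  rewrite (_ : _ \o _ = fun z => a F k t + tnth z t); last first.
    by apply/funext => z /=; rewrite tnth_mktuple.
  by apply: measurable_complexD => //; exact: measurable_tnth.
by have := mt measurableT _ (mdec k (F (D k))); rewrite setTI.
Qed.

Lemma measurable_decoded F : measurable (decoded F).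
Proof.
rewrite (_ : decoded F = \bigcap_(k in [set: 'I_(l + m)])
    ((fun y => tnth y k) @^-1` [set y | dec k y = F (D k)])); last first.
  by apply/seteqP; split => y /= h; [move=> k _|move=> k]; exact: h.
apply: fin_bigcap_measurable => // k _.
by have := measurable_tnth k measurableT (mdec k (F (D k))); rewrite setTI.
Qed.

(** The union bound, proved pointwise on indicators; the error event of user [k] depends on row [k]
    of the noise only, whence the one-row marginal. *)
Lemma decoded_prob_ge F :
  (1 <= noise (l + m) (noisy_output (a F) @^-1` decoded F) +
        \sum_(k < l + m) row_error F k)%E.
Proof.
pose A k := [set z : n.-tuple R[i] |
  dec k [tuple a F k t + tnth z t | t < n] != F (D k)].
have mA k : measurable (A k).
  rewrite (_ : A k = ~` [set z | dec k [tuple a F k t + tnth z t | t < n] = F (D k)]).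
    by apply: measurableC; exact: measurable_row_decoded.
  by apply/seteqP; split => z /=; [move/eqP|move/eqP].
have m1A k : measurable_fun setT (fun z => (\1_(A k) z : R)%:E).
  by apply/measurable_EFinP; exact: measurable_indic.
have mE : measurable (noisy_output (a F) @^-1` decoded F).
  have := measurable_noisy_output (a F) measurableT (measurable_decoded F).
  by rewrite setTI.
rewrite (_ : \sum_(k < l + m) row_error F k = \sum_(k < l + m)
    \int[noise (l + m)]_z (\1_(A k) (tnth z k))%:E)%E; last first.
  apply: eq_bigr => k _.
  rewrite (integral_iid_tnth _ k (m1A k)); last by move=> z; rewrite lee_fin.
  by rewrite integral_indic ?setIT.
have m1Ak k : measurable_fun setT
    (fun z : (l + m).-tuple (n.-tuple R[i]) => (\1_(A k) (tnth z k) : R)%:E).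
  exact: (measurableT_comp (m1A k) (measurable_tnth k)).
rewrite -ge0_integral_sum//.
rewrite -[X in (_ <= noise _ X + _)%E]setIT -integral_indic//.
rewrite -ge0_integralD//; last 3 first.
- by apply/measurable_EFinP; exact: measurable_indic.
- by move=> z _; apply: sume_ge0 => k _; rewrite lee_fin.
- exact: emeasurable_sum.
rewrite -[leLHS](integral_probability_cst (noise (l + m))).
apply: ge0_le_integral => //.
- apply: emeasurable_funD; last exact: emeasurable_sum.
  by apply/measurable_EFinP; exact: measurable_indic.
move=> z _; rewrite sumEFin -EFinD lee_fin.
have [zE|zE] := pselect (decoded F (noisy_output (a F) z)).
  rewrite indicE mem_set// lerDl; apply: sumr_ge0 => k _ //.
have [k /eqP kA] : exists k, dec k (tnth (noisy_output (a F) z) k) <> F (D k).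
  by apply/existsNP.
have kz : \1_(A k) (tnth z k) = 1 :> R.
  by rewrite indicE mem_set//; move: kA; rewrite tnth_mktuple.
rewrite (bigD1 k)//= kz.
by rewrite addrCA lerDl addr_ge0// sumr_ge0.
Qed.

(** All libraries are driven by the same noise [u], [v], whose law does not depend on [F]. The sum
    over [F] can thus be moved inside the integral, where the count [sum_side_weight_ok] holds for
    every noise sample. *)
Lemma sum_reference_decoded :
  (\sum_(F : W) ((2 ^ (L * (l + m)))%:R * side_weight F)%:E *
     \int[noise l]_u \int[noise m]_v
       (\1_(decoded F) (reference_output s (kap F) G u v))%:E <=
   #|{: W}|%:R%:E)%E.
Proof.
pose X := (l.-tuple (n.-tuple R[i]) * m.-tuple (n.-tuple R[i]))%type.
pose Q : probability X R := (noise l \x noise m)%E.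
pose h F (p : X) : \bar R :=
  (\1_(decoded F) (reference_output s (kap F) G p.1 p.2))%:E.
have mh F : measurable_fun setT (h F).
  have m1 : measurable_fun setT (fun y => (\1_(decoded F) y : R)%:E).
    by apply/measurable_EFinP; apply: measurable_indic; exact: measurable_decoded.
  exact: (measurableT_comp m1 (measurable_reference_output s (kap F) G)).
have h0 F p : (0 <= h F p)%E by rewrite lee_fin.
have c0 F : 0 <= (2 ^ (L * (l + m)))%:R * side_weight F.
  by rewrite mulr_ge0// ltW ?side_weight_gt0.
rewrite (eq_bigr (fun F => \int[Q]_p
    (((2 ^ (L * (l + m)))%:R * side_weight F)%:E * h F p))%E); last first.
  move=> F _; rewrite [RHS](ge0_integralZl Q measurableT (mh F) (fun p _ => h0 F p)); last first.
    by rewrite lee_fin.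
  congr (_ * _)%E.
  by rewrite [RHS](@fubini_tonelli1 _ _ _ _ _ (noise l) (noise m) (h F)).
rewrite -ge0_integral_sum//; last 2 first.
- by move=> F; exact: emeasurable_funM.
- by move=> F p _; apply: mule_ge0 => //; rewrite lee_fin.
rewrite -[leRHS](integral_probability_cst Q).
apply: ge0_le_integral => //.
- by move=> p _; apply: sume_ge0 => F _; apply: mule_ge0 => //; rewrite lee_fin.
- by apply: emeasurable_sum => F; exact: emeasurable_funM.
move=> p _; rewrite (eq_bigr (fun F => ((2 ^ (L * (l + m)))%:R * (side_weight F *
    (`[< decoded F (reference_output s (kap F) G p.1 p.2) >])%:R))%:E)); last first.
  by move=> F _; rewrite -EFinM indicE /in_mem/= -mulrA.
by rewrite sumEFin lee_fin -mulr_sumr; exact: sum_side_weight_ok.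
Qed.

(** Average of [codeword_bound] over the library; the final [1] is the normalized total from
    [sum_reference_decoded]. *)
Lemma averaged_converse :
  (L * (l + m))%:R * ln 2 *
    (1 - \sum_(k < l + m) #|{: W}|%:R^-1 * \sum_(F : W) fine (row_error F k)) <=
  #|{: W}|%:R^-1 * (\sum_(F : W) (- ln (side_weight F))) +
  #|{: W}|%:R^-1 * (\sum_(F : W) signal_cost s (a F)) +
  gain_const G * (4 * ((l + m) * n))%:R + 1.
Proof.
set w := #|{: W}|%:R : R; set g := gain_const G * _.
have w0 : 0 < w by rewrite ltr0n card_library_gt0.
set B := (L * (l + m))%:R * ln 2.
have B0 : 0 <= B by rewrite mulr_ge0// ln_ge0// ler1n.
pose p F := fine (noise (l + m) (noisy_output (a F) @^-1` decoded F)).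
have pE F : noise (l + m) (noisy_output (a F) @^-1` decoded F) = (p F)%:E.
  rewrite fineK// fin_num_measure//.
  have := measurable_noisy_output (a F) measurableT (measurable_decoded F).
  by rewrite setTI.
have rE F k : row_error F k = (fine (row_error F k))%:E.
  rewrite fineK// fin_num_measure//.
  rewrite (_ : [set _ | _] =
      ~` [set z | dec k [tuple a F k t + tnth z t | t < n] = F (D k)]).
    by apply: measurableC; exact: measurable_row_decoded.
  by apply/seteqP; split => z /=; [move/eqP|move/eqP].
have pge F : 1 - \sum_(k < l + m) fine (row_error F k) <= p F.
  have := decoded_prob_ge F; rewrite pE.
  under eq_bigr do rewrite rE.
  by rewrite sumEFin -EFinD lee_fin lerBlDr.
(* The weight [c] is the inverse of the pure guessing probability of the demanded files, times the
   chance of guessing the side information. With this [q], [ln c + q] equals [B] exactly. *)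
have cw F := codeword_bound s1 (fun k t => aE F k t) (measurable_decoded F)
  (c := (2 ^ (L * (l + m)))%:R * side_weight F) (q := - ln (side_weight F)) (B := B).
have sum1 : (\sum_(F : W) (B * p F)%:E <=
    \sum_(F : W) (- ln (side_weight F) + signal_cost s (a F) + g)%:E + w%:E)%E.
  apply: le_trans (leeD (lexx _) sum_reference_decoded).
  rewrite -big_split/=; apply: lee_sum => F _.
  rewrite EFinM -pE; apply: cw => //.
  - by rewrite mulr_gt0 ?side_weight_gt0// ltr0n expn_gt0.
  - by rewrite oppr_ge0 ln_le0// side_weight_le1.
  - rewrite lnM ?posrE ?side_weight_gt0 ?ltr0n ?expn_gt0//.
    by rewrite natrX lnXn// addrK /B mulr_natl.
move: sum1; rewrite !sumEFin -EFinD lee_fin => sum1.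
have sum2 : B * (w - \sum_(F : W) \sum_(k < l + m) fine (row_error F k)) <=
    \sum_(F : W) B * p F.
  rewrite -mulr_sumr ler_wpM2l//.
  have -> : w = \sum_(F : W) 1 by rewrite sumr_const.
  by rewrite -sumrB; apply: ler_sum.
have := le_trans sum2 sum1; rewrite big_split/= big_split/= sumr_const -[g *+ _]mulr_natr -/w => H.
have -> : B * (1 - \sum_(k < l + m) w^-1 * \sum_(F : W) fine (row_error F k)) =
    w^-1 * (B * (w - \sum_(F : W) \sum_(k < l + m) fine (row_error F k))).
  rewrite -mulr_sumr exchange_big/=; field; exact: lt0r_neq0.
have wi0 : 0 <= w^-1 by rewrite invr_ge0 ltW.
apply: le_trans (ler_wpM2l wi0 H) _; rewrite le_eqVlt; apply/orP; left; apply/eqP.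
by field; exact: lt0r_neq0.
Qed.

End averaging.

(** * Entropies as averages over the library *)

Section entropy.
Variable R : realType.

(** Grouping the libraries by the value of [X] turns the sum over values into a mean over [W], the
    shape in which [- ln (side_weight F)] appears. The factor [ln 2] converts bits to nats. *)
Lemma entropy_avg (W : finType) (A : eqType) (X : W -> A) :
  (entropy X : R) * ln 2 =
  #|W|%:R^-1 * \sum_(w : W) - ln (#|[pred w' | X w == X w']|%:R / #|W|%:R).
Proof.
pose p (a : A) : R := #|[pred w | X w == a]|%:R / #|W|%:R.
have -> : entropy X = - \sum_(a <- undup (codom X)) p a * log2 (p a) by [].
have pE w : #|[pred w' | X w == X w']|%:R / #|W|%:R = p (X w).
  by rewrite /p; congr (_%:R / _); apply: eq_card => w'; rewrite !inE eq_sym.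
under [in RHS]eq_bigr do rewrite pE.
have -> : \sum_(w : W) - ln (p (X w)) =
    \sum_(a <- undup (codom X)) \sum_(w | X w == a) - ln (p a).
  under [RHS]eq_bigr do rewrite big_mkcond/=.
  rewrite exchange_big/=; apply: eq_bigr => w _.
  have Xw : X w \in undup (codom X) by rewrite mem_undup codom_f.
  rewrite (bigD1_seq (X w))//= ?undup_uniq// eqxx big1 ?addr0// => a aX.
  by rewrite eq_sym (negbTE aX).
rewrite mulNr mulr_suml -sumrN mulr_sumr; apply: eq_bigr => a _.
have l2 : ln (2 : R) != 0 by rewrite gt_eqF// ln_gt0// ltr1n.
rewrite sumr_const /log2 -mulrA divfK// mulNrn mulrN; congr (- _).
rewrite -[ln _ *+ _]mulr_natl [RHS]mulrA; congr (_ * _).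
rewrite [RHS]mulrC /p; congr (_%:R / _); apply: eq_card => w; by rewrite !inE.
Qed.

Lemma sum_ffun_coord (N : nat) (T : finType) (x : 'I_N) (g : T -> R) : (0 < #|T|)%N ->
  #|{: {ffun 'I_N -> T}}|%:R^-1 * \sum_(F : {ffun 'I_N -> T}) g (F x) =
  #|T|%:R^-1 * \sum_(f : T) g f.
Proof.
(* A product with [g] at coordinate [x] and [1] elsewhere, so that distributivity factorizes the sum
   over all libraries. *)
move=> T0; pose h (i : 'I_N) t : R := if i == x then g t else 1.
have -> : \sum_(F : {ffun 'I_N -> T}) g (F x) = \prod_(i < N) \sum_t h i t.
  rewrite bigA_distr_bigA/=; apply: eq_bigr => F _.
  rewrite (bigD1 x)//= {1}/h eqxx big1 ?mulr1// => i ix.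
  by rewrite /h (negbTE ix).
rewrite (bigD1 x)//=; under eq_bigr do rewrite /h eqxx.
have -> : \prod_(i < N | i != x) \sum_t h i t = #|T|%:R ^+ N.-1.
  rewrite (eq_bigr (fun=> #|T|%:R)); last first.
    by move=> i ix; under eq_bigr do rewrite /h (negbTE ix); rewrite sumr_const.
  by rewrite prodr_const cardC1 card_ord.
have N0 : (0 < N)%N by apply: leq_ltn_trans (ltn_ord x).
rewrite card_ffun card_ord natrX -[in X in X^-1](prednK N0) exprS.
have t0 : #|T|%:R != 0 :> R by rewrite pnatr_eq0 -lt0n.
have tN := expf_neq0 N.-1 t0; rewrite invfM.
by rewrite [LHS]mulrACA mulVf// mulr1.
Qed.

Lemma card_ffun_coord (N : nat) (T : finType) (x : 'I_N) (Q : pred T) : (0 < #|T|)%N ->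
  #|[pred F : {ffun 'I_N -> T} | Q (F x)]|%:R / #|{: {ffun 'I_N -> T}}|%:R =
  #|Q|%:R / #|T|%:R :> R.
Proof.
move=> T0; have := sum_ffun_coord x (fun t => (Q t)%:R) T0.
rewrite mulrC [in RHS]mulrC => H.
transitivity ((\sum_(F : {ffun 'I_N -> T}) (Q (F x))%:R) / #|{: {ffun 'I_N -> T}}|%:R : R).
  rewrite -sum1_card natr_sum big_mkcond; congr (_ / _).
  by apply: eq_bigr => F _; rewrite inE; case: (Q _).
rewrite H -[in RHS]sum1_card natr_sum [in RHS]big_mkcond; congr (_ / _).
by apply: eq_bigr => F _; rewrite unfold_in; case: (Q _).
Qed.

Lemma ln_prod (I : finType) (f : I -> R) : (forall i, 0 < f i) ->
  ln (\prod_i f i) = \sum_i ln (f i).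
Proof.
move=> f0; suff [] : 0 < \prod_i f i /\ ln (\prod_i f i) = \sum_i ln (f i) by [].
apply: (big_ind2 (fun x y => 0 < x /\ ln x = y)); first by rewrite ln1.
  by move=> x1 y1 x2 y2 [x10 <-] [x20 <-]; rewrite mulr_gt0// lnM.
by move=> i _; split.
Qed.

End entropy.

(** * The converse for a policy *)

Section policy_converse.
Variables (R : realType) (M K N L : nat) (pol : policy R M K N L).
Variables (h : channel R K M) (mu r P eps : R) (l m : nat).
Hypotheses (hlm : (l + m <= K)%N) (hKN : (K <= N)%N).
Variables (A : {set 'I_M}) (G : 'I_m -> 'I_l -> R[i]).

Let W := library N L.
Let T := latency pol.
Let usr : 'I_(l + m) -> 'I_K := widen_ord hlm.
Let dem : demands K N := [ffun k => widen_ord hKN k].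
Let hc (k : 'I_(l + m)) (i : 'I_M) : R[i] := tnth (tnth h (usr k)) i.

Hypothesis adm : admissible pol mu r P.
Hypothesis P1 : 1 <= P.
Hypothesis err : (error_prob pol h <= eps%:E)%E.
Hypothesis GE : forall (k : 'I_m) (i : 'I_M), i \notin A ->
  hc (rshift l k) i = \sum_j G k j * hc (lshift m j) i.

Let x i (t : 'I_T) (F : W) := @edge_signal R M K N L pol i t dem h F.
Let D k := dem (usr k).
Let mean (F : W) k t := \sum_(i < M) hc k i * x i t F.
(** The part of a tail mean that the head means do not explain; by [GE] the bracketed coefficient
    vanishes outside [A], so only the signals of [A] occur. *)
Let kap (F : W) k t :=
  \sum_(i in A) (hc (rshift l k) i - \sum_j G k j * hc (lshift m j) i) * x i t F.
Let dec k y := p_decode pol (usr k) y (D k) h.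
(** For each edge node of [A], one piece for its fronthaul message and [m] pieces for its cached
    versions of the tail files. *)
Let I := ({i : 'I_M | i \in A} * (unit + 'I_m))%type.
(** The whole message; written with [take T] to match [fronthaul_constraint] at its last time. *)
Let msg i (F : W) := take T (fronthaul_message pol i dem h F).
Let cch i k (F : W) := p_cache pol i (D (rshift l k)) (F (D (rshift l k))).
Let e (p : I) : rel W := match p.2 with
  | inl _ => fun F F' => msg (val p.1) F == msg (val p.1) F'
  | inr k => fun F F' => cch (val p.1) k F == cch (val p.1) k F'
  end.

Lemma demand_inj : injective D.
Proof.
move=> k k'; rewrite /D /dem !ffunE => /(congr1 val)/= kk; exact/val_inj.
Qed.

Lemma mean_tail F k t :
  mean F (rshift l k) t = kap F k t + \sum_j G k j * mean F (lshift m j) t.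
Proof.
rewrite /mean; under [X in _ = _ + X]eq_bigr do rewrite mulr_sumr.
rewrite exchange_big/=.
have -> : kap F k t = \sum_i
    (hc (rshift l k) i - \sum_j G k j * hc (lshift m j) i) * x i t F.
  rewrite /kap [RHS](bigID (mem A))/= [X in _ = _ + X]big1 ?addr0// => i iA.
  by rewrite GE// subrr mul0r.
rewrite -big_split/=; apply: eq_bigr => i _.
rewrite mulrBl mulr_suml; under [X in _ = _ + X]eq_bigr do rewrite mulrA.
by rewrite subrK.
Qed.

(** The caches of [A] agree on the tail files by [e] and on the others because the files themselves
    agree. The edge signal at time [t] uses a prefix of the message, hence a function of the whole
    message. *)
Lemma side_info_determines F F' : (forall p, e p F F') ->
  (forall f, (forall k, f != D (rshift l k)) -> F f = F' f) -> kap F =2 kap F'.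
Proof.
move=> eFF' FF' k t; apply: eq_bigr => i iA; congr (_ * _).
pose i' : {i : 'I_M | i \in A} := exist _ i iA.
have cc : cache_content pol i F = cache_content pol i F'.
  apply/ffunP => f; rewrite !ffunE.
  have [/existsP[k' /eqP ->]|/existsPn xl] := boolP [exists k', f == D (rshift l k')].
    exact/eqP/(eFF' (i', inr k')).
  by rewrite FF'.
rewrite /x /edge_signal cc; congr (p_edge _ _ _ _ _ _ _).
have /eqP := eFF' (i', inl tt); rewrite /msg/= => mm.
have tk (s : T.-tuple (fronthaul_alphabet pol)) : take t s = take t (take T s).
  by rewrite take_takel// ltnW.
by rewrite tk mm -tk.
Qed.

Lemma avg_side_information :
  #|{: W}|%:R^-1 * (\sum_(F : W) - ln (side_weight R e F)) <=
  #|A|%:R * (T%:R * r * ln P + m%:R * (mu * L%:R * ln 2)).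
Proof.
have [cacheC frontC _ _] := adm.
have l2 : ln (2 : R) > 0 by rewrite ln_gt0// ltr1n.
pose b (o : unit + 'I_m) : R :=
  if o is inl _ then T%:R * r * ln P else mu * L%:R * ln 2.
have wgt (p : I) F : 0 < #|[pred F' | e p F F']|%:R / #|{: W}|%:R :> R.
  rewrite divr_gt0// ltr0n ?card_library_gt0//; apply/card_gt0P; exists F.
  by rewrite inE /e; case: p.2.
have -> : \sum_(F : W) - ln (side_weight R e F) =
    \sum_(p : I) \sum_(F : W) - ln (#|[pred F' | e p F F']|%:R / #|{: W}|%:R).
  rewrite exchange_big/=; apply: eq_bigr => F _.
  by rewrite /side_weight ln_prod// sumrN.
rewrite mulr_sumr; apply: (@le_trans _ _ (\sum_(p : I) b p.2)).
  apply: ler_sum => -[i [[]|k]] _; rewrite /e/=.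
    rewrite -(entropy_avg R (msg (val i))).
    apply: (le_trans (ler_wpM2r (ltW l2) (frontC (val i) dem h T (leqnn _)))).
    by rewrite /log2 -!mulrA mulVf ?mulr1//; exact: lt0r_neq0.
  apply: (le_trans _ (ler_wpM2r (ltW l2) (cacheC (val i) (D (rshift l k))))).
  have c0 : (0 < #|{: file L}|)%N by rewrite card_ord expn_gt0.
  (* The cache entropy is taken over a single file, whereas [side_weight] counts libraries; one
     coordinate of a uniform library is uniform. *)
  rewrite (entropy_avg R (p_cache pol (val i) (D (rshift l k)))).
  rewrite -(@sum_ffun_coord R N (file L) (D (rshift l k)) _ c0).
  rewrite le_eqVlt; apply/orP; left; apply/eqP.
  congr (_ * _); apply: eq_bigr => F _; congr (- ln _).
  exact: (card_ffun_coord R (D (rshift l k))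
    (fun f' => cch (val i) k F == p_cache pol (val i) (D (rshift l k)) f') c0).
rewrite -(pair_bigA _ (fun _ o => b o))/= sumr_const card_sig.
rewrite big_sumType/= !sumr_const card_unit card_ord mulr1n.
rewrite le_eqVlt; apply/orP; left; apply/eqP.
by rewrite -[LHS]mulr_natl; congr (_ * (_ + _)); rewrite mulr_natl.
Qed.

(** With [s ^+ 2 = P] the logarithm costs [ln P] per head symbol. Cauchy-Schwarz over the edge nodes
    and the power constraint bound the received energy by [T * P] times a channel constant, and the
    division by [P] removes the power. *)
Lemma avg_signal_cost : #|{: W}|%:R^-1 * (\sum_(F : W) signal_cost (Num.sqrt P) (mean F)) <=
  (l * T)%:R * ln P +
  T%:R * (2 * \sum_(k < l) M%:R * \sum_(i < M) normsq (hc (lshift m k) i)).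
Proof.
have [_ _ powC _] := adm.
have P0 : 0 < P by rewrite (lt_le_trans ltr01).
set w := #|{: W}|%:R : R.
have w0 : 0 < w by rewrite ltr0n card_library_gt0.
have avgc (c : R) : w^-1 * (\sum_(F : W) c) = c.
  by rewrite sumr_const -[c *+ _]mulr_natl -/w mulKf ?gt_eqF.
rewrite /signal_cost sqr_sqrtr ?(ltW P0)// big_split/= mulrDr avgc lerD2l.
rewrite -mulr_sumr -mulr_suml (mulrCA w^-1) (mulrCA T%:R) ler_pM2l//.
rewrite mulrA ler_pdivrMr// -mulrA mulr_suml.
rewrite exchange_big/= mulr_sumr mulr_sumr; apply: ler_sum => k _.
have step F : \sum_(t < T) normsq (mean F (lshift m k) t) <=
    M%:R * \sum_(i < M) normsq (hc (lshift m k) i) * \sum_(t < T) normsq (x i t F).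
  under [X in _ <= _ * X]eq_bigr do rewrite mulr_sumr.
  rewrite exchange_big/= mulr_sumr; apply: ler_sum => t _.
  apply: le_trans (normsq_sum _) _.
  by apply: ler_wpM2l => //; apply: ler_sum => i _; rewrite normsqM.
have wi : 0 <= w^-1 by rewrite invr_ge0 ltW.
apply: (le_trans (ler_wpM2l wi (ler_sum _ (fun F _ => step F)))).
rewrite -mulr_sumr exchange_big/=.
rewrite (mulrCA w^-1) -[X in T%:R * X]mulrA (mulrCA T%:R) ler_wpM2l//.
rewrite mulr_sumr mulr_suml mulr_sumr; apply: ler_sum => i _.
rewrite -mulr_sumr (mulrCA w^-1) (mulrCA T%:R) ler_wpM2l ?normsq_ge0//.
exact: powC.
Qed.

(** [user_error_prob] is computed with the noise of all [K] users, [row_error] with that of one; the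
    two agree by marginalization. *)
Lemma user_errors k : #|{: W}|%:R^-1 *
  \sum_(F : W) fine (row_error D mean dec F k) <= eps.
Proof.
have [_ _ _ mdec] := adm.
have mA F : measurable [set z : T.-tuple R[i] |
    dec k [tuple mean F k t + tnth z t | t < T] != F (D k)].
  rewrite (_ : [set _ | _] = ~` [set z | dec k [tuple mean F k t + tnth z t | t < T] = F (D k)]).
    apply: measurableC; apply: measurable_row_decoded => k' f; exact: mdec.
  by apply/seteqP; split => z /=; [move/eqP|move/eqP].
have ue : (user_error_prob pol h dem (usr k) <= eps%:E)%E.
  apply: le_trans err; rewrite /error_prob.
  apply: le_trans (le_bigmax _ _ dem).
  exact: le_bigmax.
rewrite -lee_fin; apply: le_trans ue; rewrite /user_error_prob EFinM -sumEFin.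
rewrite le_eqVlt; apply/orP; left; apply/eqP; congr (_ * _)%E.
apply: eq_bigr => F _; rewrite fineK; last by rewrite fin_num_measure.
rewrite /row_error -[in LHS](setIT [set _ | _]) -integral_indic//.
rewrite -(integral_iid_tnth _ (usr k)); last 2 first.
- by apply/measurable_EFinP; exact: measurable_indic.
- by move=> z; rewrite lee_fin.
rewrite -[RHS]/(iid_law _ K ((fun z => tnth z (usr k)) @^-1` [set z : T.-tuple R[i] |
    dec k [tuple mean F k t + tnth z t | t < T] != F (D k)])).
rewrite -[X in _ = iid_law _ K X]setIT -integral_indic//.
have := measurable_tnth (usr k) measurableT (mA F).
by rewrite setTI.
Qed.

Lemma policy_bound :
  (L * (l + m))%:R * ln 2 * (1 - (l + m)%:R * eps) <=
  T%:R * (#|A|%:R * r + l%:R) * ln P + #|A|%:R * m%:R * mu * L%:R * ln 2 +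
  T%:R * (2 * (\sum_(k < l) M%:R * \sum_(i < M) normsq (hc (lshift m k) i)) +
          gain_const G * (4 * (l + m))%:R) + 1.
Proof.
have [_ _ _ mdec] := adm.
have s1 : 1 <= Num.sqrt P by rewrite -[leLHS]sqrtr1 ler_wsqrtr.
have H := @averaged_converse R N L l m T (Num.sqrt P) D mean kap G dec I e s1
  demand_inj mean_tail (fun k f => mdec _ _ _ _).
have e_refl p : reflexive (e p) by case: p => i [[]|k] F; rewrite /e/=.
have e_sym p : symmetric (e p) by case: p => i [[]|k] F F'; rewrite /e/= eq_sym.
have e_trans p : transitive (e p).
  by case: p => i [[]|k] F F' F''; rewrite /e/= => /eqP -> /eqP ->.
have := H e_refl e_sym e_trans side_info_determines.
have eb : \sum_(k < l + m) #|{: W}|%:R^-1 *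
    \sum_(F : W) fine (row_error D mean dec F k) <= (l + m)%:R * eps.
  apply: (@le_trans _ _ (\sum_(k < l + m) eps)).
    by apply: ler_sum => k _; exact: user_errors.
  by rewrite sumr_const card_ord mulr_natl.
have B0 : 0 <= (L * (l + m))%:R * ln (2 : R) by rewrite mulr_ge0// ln_ge0// ler1n.
have := avg_side_information; have := avg_signal_cost.
set a1 := _^-1 * _; set a2 := _^-1 * _ => h2 h1 h3.
apply: le_trans (_ : _ <= (L * (l + m))%:R * ln (2 : R) * (1 - \sum_(k < l + m)
  #|{: W}|%:R^-1 * \sum_(F : W) fine (row_error D mean dec F k))) _.
  by rewrite ler_wpM2l// lerD2l lerN2.
apply: (le_trans h3); rewrite !natrM !natrD in h2 *; lra.
Qed.

End policy_converse.

(** * Generic channels *)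

Section generic_channel.
Variable R : realType.

Section null_events.
Context d (X : measurableType d) (P : probability X R).

Lemma iid_null_tail n (S : set (n.+1.-tuple X)) : measurable S ->
  (forall x, iid_law P n [set z | S (tcons (x, z))] = 0%E) ->
  iid_law P n.+1 S = 0%E.
Proof.
move=> mS S0.
have m1 : measurable_fun setT (fun z => (\1_S z : R)%:E).
  by apply/measurable_EFinP; exact: measurable_indic.
rewrite -[S]setIT -integral_indic// integral_iidS//.
apply: integral0_eq => x _.
have mx : measurable [set z | S (tcons (x, z))].
  have := measurableT_comp (@measurable_tcons _ X n) (pair1_measurable x).
  by move=> /(_ measurableT _ mS); rewrite setTI.
by rewrite -[RHS](S0 x) -[in RHS](setIT [set _ | _]) -integral_indic.
Qed.

(** Tonelli with the first coordinate integrated innermost: the probability of the slice at [z] is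
    at most the indicator of [B], whose integral is zero. *)
Lemma iid_null_head n (S : set (n.+1.-tuple X)) (B : set (n.-tuple X)) :
  measurable S -> measurable B -> iid_law P n B = 0%E ->
  (forall z, ~ B z -> P [set x | S (tcons (x, z))] = 0%E) ->
  iid_law P n.+1 S = 0%E.
Proof.
move=> mS mB B0 S0.
have m1 : measurable_fun setT (fun z => (\1_S z : R)%:E).
  by apply/measurable_EFinP; exact: measurable_indic.
pose f (p : X * n.-tuple X) : \bar R := (\1_S (tcons p))%:E.
have mf : measurable_fun setT f.
  exact: (measurableT_comp m1 (@measurable_tcons _ X n)).
have f0 p : (0 <= f p)%E by rewrite lee_fin.
have mz z : measurable [set x | S (tcons (x, z))].
  have := measurableT_comp (@measurable_tcons _ X n) (pair2_measurable z).
  by move=> /(_ measurableT _ mS); rewrite setTI.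
rewrite -[S]setIT -integral_indic// integral_iidS//.
rewrite (fubini_tonelli f mf f0)//.
apply/eqP; rewrite eq_le; apply/andP; split; last first.
  by apply: integral_ge0 => z _; exact: integral_ge0.
rewrite -B0 -[B in leRHS]setIT -integral_indic//.
have fz z : (\int[P]_x f (x, z) = P [set x | S (tcons (x, z))])%E.
  by rewrite -[in RHS](setIT [set _ | _]) -integral_indic.
apply: ge0_le_integral => //.
- by move=> z _; exact: integral_ge0.
- exact: (@measurable_fun_fubini_tonelli_G _ _ _ _ _ P f mf f0).
- by apply/measurable_EFinP; exact: measurable_indic.
move=> z _; rewrite fz; have [Bz|Bz] := pselect (B z).
  by rewrite indicE mem_set//; exact: probability_le1.
by rewrite S0// lee_fin.
Qed.

End null_events.

Lemma measurable_complex_eq d (T : measurableType d) (f : T -> R[i]) (c : R[i]) :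
  measurable_fun setT f -> measurable [set x | f x = c].
Proof.
move=> /measurable_complexP[mre mim].
rewrite (_ : [set x | f x = c] =
    ((fun x => complex.Re (f x) : measurableTypeR R) @^-1` [set complex.Re c]) `&`
    ((fun x => complex.Im (f x) : measurableTypeR R) @^-1` [set complex.Im c])).
  apply: measurableI.
    by have := mre measurableT _ (measurable_set1 (complex.Re c)); rewrite setTI.
  by have := mim measurableT _ (measurable_set1 (complex.Im c)); rewrite setTI.
apply/seteqP; split => x /= [].
  by move=> ->.
by case: (f x) c => [? ?] [? ?]/= -> ->.
Qed.

Variable nu : probability R[i] R.
Hypothesis nu0 : forall z : R[i], nu [set z] = 0%E.

(** If the first coefficient is nonzero, the other coordinates force the first one to a single
    point, which [nu] does not charge; otherwise that coordinate is irrelevant to the equation and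
    the induction hypothesis applies. *)
Lemma iid_hyperplane_null M (c : 'I_M -> R[i]) (b : R[i]) i0 : c i0 != 0 ->
  iid_law nu M [set v | \sum_(i < M) c i * tnth v i = b] = 0%E.
Proof.
have mS n (e : 'I_n -> R[i]) (b' : R[i]) :
    measurable [set v : n.-tuple R[i] | \sum_(i < n) e i * tnth v i = b'].
  apply: measurable_complex_eq; apply: measurable_complex_sum => i.
  by apply: measurable_complexM => //; exact: measurable_tnth.
elim: M c b i0 => [c b []//|M IH c b i0 ci0].
have [c0|c0] := eqVneq (c ord0) 0; last first.
  apply: (@iid_null_head _ _ _ M _ set0) => //.
  move=> z _; pose s := \sum_(i < M) c (lift ord0 i) * tnth z i.
  have SE x : \sum_(i < M.+1) c i * tnth (tcons (x, z)) i = c ord0 * x + s.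
    by rewrite big_ord_recl tnth0; under eq_bigr do rewrite tnthS.
  rewrite -(nu0 ((b - s) / c ord0)); congr (nu _); apply/seteqP; split => x /=.
    by rewrite SE => <-; rewrite addrK mulrC mulKf.
  by move=> ->; rewrite SE mulrC divfK// subrK.
apply: iid_null_tail => // x.
case: (unliftP ord0 i0) ci0 => [j|] ->; last by rewrite c0 eqxx.
move=> /(IH (fun i => c (lift ord0 i)) b) <-; congr (iid_law _ _ _).
have SE z : \sum_(i < M.+1) c i * tnth (tcons (x, z)) i =
    \sum_(i < M) c (lift ord0 i) * tnth z i.
  by rewrite big_ord_recl c0 mul0r add0r; under eq_bigr do rewrite tnthS.
by apply/seteqP; split => z /=; rewrite SE.
Qed.

Definition channel_minor K M l (hl : (l <= K)%N) (g : 'I_l -> 'I_M)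
    (h : K.-tuple (M.-tuple R[i])) : 'M[R[i]]_l :=
  \matrix_(i, j) tnth (tnth h (widen_ord hl i)) (g j).

Lemma measurable_det_minor K M l (hl : (l <= K)%N) (g : 'I_l -> 'I_M) :
  measurable [set h | \det (channel_minor hl g h) = 0].
Proof.
apply: measurable_complex_eq; apply: measurable_complex_sum => s.
apply: measurable_complexM => //; apply: measurable_complex_prod => i.
rewrite (_ : (fun _ => _) = fun h => tnth (tnth h (widen_ord hl i)) (g (s i))).
  exact: measurable_entry.
by apply/funext => h; rewrite mxE.
Qed.

(* Expanding along the first row, the determinant is a linear form in that row
   whose coefficient at [g ord0] is the minor of the remaining rows. *)
Lemma channel_minor_singular_null K M l (hl : (l <= K)%N) (g : 'I_l -> 'I_M) :
  injective g -> channel_law K M nu [set h | \det (channel_minor hl g h) = 0] = 0%E.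
Proof.
rewrite /channel_law; elim: l K hl g => [|l IH] K hl g ginj.
  rewrite (_ : [set _ | _] = set0) ?measure0//; apply/seteqP; split => h //=.
  by rewrite det_mx00 => /eqP; rewrite oner_eq0.
case: K hl => [//|K] hl.
pose g' j i : 'I_M := g (lift j i).
apply: (@iid_null_head _ _ _ K _
  [set h | \det (channel_minor (hl : (l <= K)%N) (g' ord0) h) = 0]).
- exact: measurable_det_minor.
- exact: measurable_det_minor.
- by apply: IH => i j /ginj/lift_inj.
move=> z /= z0.
pose C (j : 'I_l.+1) : R[i] :=
  (-1) ^+ (@ord0 l + j) * \det (channel_minor (hl : (l <= K)%N) (g' j) z).
pose c i := \sum_(j < l.+1 | g j == i) C j.
have detE x : \det (channel_minor hl g (tcons (x, z))) = \sum_(i < M) c i * tnth x i.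
  rewrite (expand_det_row _ ord0).
  rewrite (eq_bigr (fun j => C j * tnth x (g j))); last first.
    move=> j _; rewrite mxE (_ : widen_ord hl ord0 = ord0); last exact/val_inj.
    rewrite tnth0 mulrC; congr (_ * _); rewrite /cofactor; congr (_ * \det _).
    apply/matrixP => i k; rewrite !mxE.
    rewrite (_ : widen_ord hl (lift ord0 i) = lift ord0 (widen_ord (hl : (l <= K)%N) i)).
      by rewrite tnthS.
    exact/val_inj.
  rewrite (partition_big g predT)//=; apply: eq_bigr => i _.
  by rewrite /c mulr_suml; apply: eq_bigr => j /eqP <-.
rewrite (_ : [set _ | _] = [set x | \sum_(i < M) c i * tnth x i = 0]).
  apply: (@iid_hyperplane_null _ _ _ (g ord0)).
  rewrite /c (big_pred1 ord0) => [|j]; last by rewrite /= (inj_eq ginj).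
  by rewrite /C mul1r; apply/eqP.
by apply/seteqP; split => x /=; rewrite detE.
Qed.

End generic_channel.

(** * Asymptotics *)

Section ndt_lower_bound.
Variable R : realType.

Lemma limn_esup_lt (u : (\bar R)^nat) (x : \bar R) : (limn_esup u < x)%E ->
  exists n0, forall n, (n0 <= n)%N -> (u n < x)%E.
Proof.
move=> /ereal_inf_lt[_ [A [n0 _ nA] <-] Ax]; exists n0 => n n0n.
apply: le_lt_trans Ax; apply: ereal_sup_ubound; exists n => //.
exact: nA.
Qed.

Lemma lte_fin_between (x : \bar R) (b : R) : (x < b%:E)%E ->
  exists2 y : R, (x < y%:E)%E & y < b.
Proof.
case: x => [x| |]; rewrite ?lte_fin => xb //.
  by exists ((x + b) / 2); rewrite ?lte_fin midf_lt.
by exists (b - 1); [exact: ltNyr|lra].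
Qed.

(** After division by [L * ln2] the slack [gam] would have to fit into three error terms, from
    decoding errors, from the channel constant [C] and from the additive [1], each at most
    [gam / 4]. *)
Lemma no_vanishing_slack (T L J alpha beta C p d gam eps ln2 : R) :
  0 < ln2 -> 0 < L -> 0 < p -> 0 <= alpha -> 0 <= C -> 0 < gam ->
  J = gam + d * alpha + beta -> 0 <= T ->
  L * J * ln2 * (1 - J * eps) <= T * alpha * p + beta * L * ln2 + T * C + 1 ->
  T * p <= d * L * ln2 -> d * C <= p * (gam / 4) ->
  J * (J * eps) <= gam / 4 -> 1 <= L * ln2 * (gam / 4) -> False.
Proof.
move=> l20 L0 p0 a0 C0 g0 JE T0 H Tp dC Je L1.
have Ll : 0 < L * ln2 by rewrite mulr_gt0.
have h1 : T * alpha * p <= L * ln2 * (d * alpha).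
  have := ler_wpM2r a0 Tp; lra.
have h2 : T * C <= L * ln2 * (gam / 4).
  rewrite -(ler_pM2r p0).
  have := ler_wpM2r C0 Tp; have := ler_wpM2l (ltW Ll) dC; lra.
have h3 := ler_wpM2l (ltW Ll) Je.
have h4 : L * ln2 * (gam / 4) > 0 by rewrite mulr_gt0// divr_gt0.
have : L * ln2 * J = L * ln2 * gam + L * ln2 * (d * alpha) + L * ln2 * beta.
  by rewrite JE; ring.
lra.
Qed.

Lemma achievable_ndt_ge (M K N : nat) (nu : probability R[i] R) (mu r : R)
    (l m : nat) (hlm : (l + m <= K)%N) (hKN : (K <= N)%N) (A : {set 'I_M})
    (B : set (channel R K M)) (delta : \bar R) :
  0 < r -> (0 < l + #|A|)%N ->
  measurable B -> channel_law K M nu B = 0%E ->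
  (forall h, ~ B h -> exists G : 'I_m -> 'I_l -> R[i], forall k i, i \notin A ->
    tnth (tnth h (widen_ord hlm (rshift l k))) i =
    \sum_j G k j * tnth (tnth h (widen_ord hlm (lshift m j))) i) ->
  achievable_ndt M K N nu mu r delta ->
  ((((l + m)%:R - #|A|%:R * m%:R * mu) / (l%:R + #|A|%:R * r))%:E <= delta)%E.
Proof.
move=> r0 lA mB B0 BG [pol [polP polcvg]]; rewrite leNgt; apply/negP.
move=> /lte_fin_between[d deltad db].
pose alpha := #|A|%:R * r + l%:R; pose beta := #|A|%:R * m%:R * mu.
have a0 : 0 < alpha.
  move: lA; rewrite addn_gt0 /alpha => /orP[l0|A0].
    by rewrite ltr_wpDl ?ltr0n// mulr_ge0// ltW.
  by rewrite ltr_pwDl// mulr_gt0// ltr0n.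
(* [gam] is the slack between [d] and the claimed bound, cleared of its denominator. *)
pose J := (l + m)%:R : R; pose gam := J - d * alpha - beta.
have g0 : 0 < gam.
  move: db; rewrite ltr_pdivlMr; last by rewrite addrC.
  by rewrite /gam /alpha /beta /J [l%:R + _]addrC; lra.
have nearP : \forall P \near +oo, [/\ forall L, admissible (pol P L) mu r P,
    feasible nu (pol P) & (normalized_latency P (pol P) < d%:E)%E].
  have Pd : \forall P \near +oo, (normalized_latency P (pol P) < d%:E)%E.
    exact: (polcvg _ (open_ereal_lt' deltad)).
  near=> P; have [] : (forall L, admissible (pol P L) mu r P) /\ feasible nu (pol P).
    by near: P.
  by split => //; near: P.
have [P0 [_ nearP']] := nearP.
(* A sequence tending to infinity that stays beyond the threshold [P0]; the summand [2] also keeps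
   [ln] positive. *)
pose P1 := `|P0| + 2; pose Pn (n : nat) : R := n%:R + P1.
have PnP0 n : P0 < Pn n.
  by rewrite /Pn /P1 (le_lt_trans (ler_norm P0))//; have := ler0n R n; lra.
have PnG n := nearP' _ (PnP0 n).
(* Feasibility is almost sure for each power separately; countably many powers leave a common
   channel, also outside [B]. *)
have : \forall h \ae channel_law K M nu, ~ B h /\
    forall n, (fun L => error_prob (pol (Pn n) L) h) @ \oo --> 0%E.
  apply: filterI.
    by exists B; split => // h /= /contrapT.
  by apply: ae_foralln => n; have [_] := PnG n.
have PF : ProperFilter (almost_everywhere (channel_law K M nu)).
  apply: ae_properfilter_algebraOfSetsType.
  exact: (eq_ind_r (fun x => 0 < x)%E lte01 (probability_setT (channel_law K M nu))).
move=> /filter_ex[h [nB hcvg]].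
have [G GE] := BG h nB.
pose C := 2 * (\sum_(k < l) M%:R *
    \sum_(i < M) normsq (tnth (tnth h (widen_ord hlm (lshift m k))) i)) +
  gain_const G * (4 * (l + m))%:R.
have C0 : 0 <= C.
  rewrite addr_ge0// mulr_ge0 ?gain_const_ge0//.
  apply: sumr_ge0 => k _; rewrite mulr_ge0//; apply: sumr_ge0 => i _; exact: normsq_ge0.
(* The channel is now fixed, hence so is [C]; this [n] makes [ln P] at least [4 * |d| * C / gam]. *)
pose n := Num.bound (expR (4 * `|d| * C / gam)).
pose P := Pn n.
have n1 : expR (4 * `|d| * C / gam) <= P.
  apply: ltW; apply: (@lt_le_trans _ _ n%:R).
    by have := archi_boundP (expR_ge0 (4 * `|d| * C / gam)).
  by rewrite lerDl addr_ge0.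
have P2 : 2 <= P.
  by rewrite /P /Pn /P1; have := ler0n R n; have := normr_ge0 P0; lra.
have p0 : 0 < ln P by rewrite ln_gt0//; lra.
have dC : d * C <= ln P * (gam / 4).
  have : 4 * `|d| * C / gam <= ln P by rewrite -[leLHS]expRK ler_ln ?posrE ?expR_gt0//; lra.
  rewrite ler_pdivrMr// => h1.
  have := ler_wpM2r C0 (ler_norm d); lra.
have [adm _ latd] := PnG n; rewrite -/P in adm latd.
have [n1' latL] := limn_esup_lt latd.
(* Makes [J * (J * eps)] at most [gam / 4]. *)
pose eps := gam / 4 / (J ^+ 2 + 1).
have J2 : 0 < J ^+ 2 + 1 by rewrite ltr_wpDl// sqr_ge0.
have eps0 : 0 < eps by rewrite !divr_gt0.
have [n2 _ errL] : \forall L \near \oo, (error_prob (pol P L) h < eps%:E)%E.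
  have e0 : (0%E < eps%:E)%E by rewrite lte_fin.
  exact: (hcvg n _ (open_ereal_lt' e0)).
have l2 : 0 < ln (2 : R) by rewrite ln_gt0// ltr1n.
(* Past [n3] the additive [1] is at most a quarter of the slack; the successor in [L] ensures a
   positive file size. *)
pose n3 := Num.bound (4 / (gam * ln 2)).
pose L := maxn (maxn n1' n2) n3.+1.
have Ln1 : (n1' <= L)%N by rewrite /L !leq_max leqnn.
have Ln2 : (n2 <= L)%N by rewrite /L !leq_max leqnn orbT.
have Ln3 : (n3 < L)%N by rewrite /L !leq_max leqnn orbT.
have L0 : 0 < L%:R :> R by rewrite ltr0n (leq_ltn_trans _ Ln3).
have P1' : 1 <= P by lra.
have pb := policy_bound hKN (adm L) P1' (ltW (errL L Ln2)) GE.
apply: (@no_vanishing_slack (latency (pol P L))%:R L%:R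
  J alpha beta C (ln P) d gam eps (ln 2)) => //.
- exact: ltW.
- by rewrite /gam; ring.
- by move: pb; rewrite natrM -/C -/alpha -/J /beta; lra.
- have := latL L Ln1; rewrite lte_fin /log2 => /ltW.
  rewrite ler_pdivrMr; last by rewrite !divr_gt0.
  move=> h1; have := ler_wpM2r (ltW p0) h1.
  have -> : d * (L%:R / (ln P / ln 2)) * ln P = d * L%:R * ln 2.
    by field; rewrite !gt_eqF.
  by [].
- rewrite mulrA -expr2 /eps mulrCA ler_piMr//; first by rewrite ltW// divr_gt0.
  by rewrite ler_pdivrMr// mul1r lerDl.
- have : 4 / (gam * ln 2) <= L%:R.
    apply: ltW; apply: (@lt_le_trans _ _ n3%:R); last by rewrite ler_nat ltnW.
    have h0 : 0 <= 4 / (gam * ln 2) by rewrite divr_ge0// mulr_ge0// ltW.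
    by have := archi_boundP h0.
  rewrite ler_pdivrMr ?mulr_gt0//; lra.
Unshelve. all: by end_near. Qed.

End ndt_lower_bound.

Theorem corollary4 (R : realType) (M K N : nat) (nu : probability R[i] R)
    (mu r : R) (hM : (0 < M)%N) (hK : (0 < K)%N) (hKN : (K <= N)%N)
    (hnu : forall z : R[i], nu [set z] = 0%E)
    (hmu : 0 <= mu <= 1) (hr : 0 < r) :
  (maxe
     (\big[maxe/-oo]_(l < (minn M K).+1)
        ((K%:R - (M%:R - l%:R) * (K%:R - l%:R) * mu)
         / (l%:R + (M%:R - l%:R) * r))%:E)
     1
   <= min_ndt M K N nu mu r)%E.
Proof.
apply: le_ereal_inf_tmp => delta /= hdelta; rewrite ge_max; apply/andP; split.
  apply/bigmax_leP; split => [|l _]; first exact: leNye.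
  have : (l <= minn M K)%N by rewrite -ltnS.
  rewrite leq_min => /andP[lM lK].
  have hlm : (l + (K - l) <= K)%N by rewrite subnKC.
  (* The first [M - l] edge nodes provide side information. The last [l], enumerated by [g] below,
     form with the first [l] users the square minor to be inverted. *)
  pose A : {set 'I_M} := finset (fun i : 'I_M => (i < M - l)%N).
  have cA : #|A| = (M - l)%N.
    have winj : injective (widen_ord (leq_subr l M)).
      by move=> i j /(congr1 val) ij; exact/val_inj.
    rewrite -[RHS]card_ord -(fintype.card_image winj); apply: eq_card => i.
    rewrite inE; apply/idP/fintype.imageP => [iM|[j _ ->]]; last exact: (valP j).
    by exists (Ordinal iM) => //; exact/val_inj.
  have gP (j : 'I_l) : (M - l + j < M)%N by rewrite -[ltnRHS](subnK lM) ltn_add2l.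
  pose g (j : 'I_l) : 'I_M := Ordinal (gP j).
  have ginj : injective g by move=> i j /(congr1 val)/addnI ij; exact/val_inj.
  have := @achievable_ndt_ge R M K N nu mu r l (K - l) hlm hKN A
    [set h | \det (channel_minor lK g h) = 0] delta hr.
  have -> : (l + (K - l))%:R = K%:R :> R by rewrite subnKC.
  rewrite cA !natrB// subnKC//; apply => //.
  - exact: measurable_det_minor.
  - exact: channel_minor_singular_null.
  move=> h /= /eqP h0.
  pose H := channel_minor lK g h.
  have Hu : H \in unitmx by rewrite unitmxE unitfE.
  pose v (k : 'I_(K - l)) : 'rV[R[i]]_l :=
    \row_j tnth (tnth h (widen_ord hlm (rshift l k))) (g j).
  (* The row of a tail user on the last [l] edge nodes is expanded in the rows of the head users by
     inverting the minor. *)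
  exists (fun k j => (v k *m invmx H) 0 j) => k i.
  rewrite inE -leqNgt => Mi.
  have il : (i - (M - l) < l)%N by rewrite ltn_subLR// subnK.
  have -> : i = g (Ordinal il) by apply/val_inj; rewrite /= subnKC.
  transitivity (v k 0 (Ordinal il)); first by rewrite mxE.
  rewrite -[v k in LHS](mulmxKV Hu) mxE; apply: eq_bigr => j _.
  congr (_ * _); rewrite mxE; congr (tnth (tnth _ _) _); exact/val_inj.
(* With one head user, no tail user and [A] empty, the bound reads [(1 - 0) / (1 + 0)], and every
   channel qualifies. *)
have := @achievable_ndt_ge R M K N nu mu r 1 0 hK hKN finset.set0 set0 delta hr.
rewrite cards0 !mul0r subr0 addr0 divr1; apply => //.
by move=> h _; exists (fun _ _ => 0) => -[].
Qed.
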